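(* Let $n\geq 2$ and let $\mathcal{M}$ be an $n$-cluster tilting subcategory of $\mathcal{B}$. If $\mathcal{B}$ has an $(n-1)$-AR translation $\tau_{n-1}$, then the diagram $$\begin{array}{ccc} {}^{\bot_{n-2}}\mathcal{M}/[\mathcal{M}] & \xrightarrow{\;F\;} & \operatorname{mod}\underline{\mathcal{M}}\\ {\scriptstyle\tau_{n-1}}\downarrow & & \downarrow{\scriptstyle\mu}\\ \mathcal{M}^{\bot_{n-2}}/[\overline{\Omega}\mathcal{M}] & \xrightarrow{\;G\;} & \operatorname{mod}\overline{\mathcal{M}} \end{array}$$ is commutative up to natural isomorphism, i.e. $G\circ\tau_{n-1}\simeq\mu\circ F$ as functors.
   Context: $k$ is a field, $D=\operatorname{Hom}_k(-,k)$, and $\mathcal{B}$ is a $k$-linear, Hom-finite, Krull-Schmidt exact category (in the sense of Quillen) with enough projectives and enough injectives; $\mathcal{P}$, $\mathcal{I}$ are the full subcategories of projective and injective objects. For a subcategory $\mathcal{C}$, $[\mathcal{C}](X,Y)$ is the set of morphisms factoring through an object of $\mathcal{C}$, and the quotient by $[\mathcal{C}]$ has the same objects and morphisms $\operatorname{Hom}(X,Y)/[\mathcal{C}](X,Y)$. For $\mathcal{C}\supseteq\mathcal{P}$ (resp. $\mathcal{C}\supseteq\mathcal{I}$), $\underline{\mathcal{C}}=\mathcal{C}/[\mathcal{P}]$ (resp. $\overline{\mathcal{C}}=\mathcal{C}/[\mathcal{I}]$), with morphisms $\underline{\operatorname{Hom}}$ (resp. $\overline{\operatorname{Hom}}$).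 A subcategory $\mathcal{M}$ is $n$-cluster tilting if it is contravariantly and covariantly finite in $\mathcal{B}$, and for $X\in\mathcal{B}$: $X\in\mathcal{M}\iff\operatorname{Ext}^i_{\mathcal{B}}(X,\mathcal{M})=0$ for $1\le i\le n-1$ $\iff\operatorname{Ext}^i_{\mathcal{B}}(\mathcal{M},X)=0$ for $1\le i\le n-1$. For a class $\mathcal{C}$, ${}^{\bot_{n-2}}\mathcal{C}=\{X\in\mathcal{B}\mid\operatorname{Ext}^i_{\mathcal{B}}(X,\mathcal{C})=0,\ 1\le i\le n-2\}$ and $\mathcal{C}^{\bot_{n-2}}=\{X\in\mathcal{B}\mid\operatorname{Ext}^i_{\mathcal{B}}(\mathcal{C},X)=0,\ 1\le i\le n-2\}$. $\overline{\Omega}\mathcal{M}$ is the full subcategory of objects $X$ with a short exact sequence $0\to M\to I\to X\to0$, $M\in\mathcal{M}$, $I\in\mathcal{I}$. Modules: for an additive $k$-linear category $\mathcal{D}$, $\operatorname{Mod}\mathcal{D}$ is the category of contravariant additive functors $\mathcal{D}\to\operatorname{mod}k$, and $\operatorname{mod}\mathcal{D}$ its full subcategory of functors $A$ with an exact sequence $\operatorname{Hom}_{\mathcal{D}}(-,D_1)\to\operatorname{Hom}_{\mathcal{D}}(-,D_0)\to A\to0$. AR translations: an AR translation is an equivalence $\tau:\underline{\mathcal{B}}\to\overline{\mathcal{B}}$ with quasi-inverse $\tau^-$ and functorial isomorphisms $\operatorname{Ext}^1_{\mathcal{B}}(X,Y)\simeq D\overline{\operatorname{Hom}}_{\mathcal{B}}(Y,\tau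 X)\simeq D\underline{\operatorname{Hom}}_{\mathcal{B}}(\tau^-Y,X)$. The $(n-1)$-AR translations are $\tau_{n-1}=\tau\Omega^{n-2}:\underline{{}^{\bot_{n-2}}\mathcal{P}}\to\overline{\mathcal{I}^{\bot_{n-2}}}$ and $\tau_{n-1}^-=\tau^-\overline{\Omega}^{n-2}:\overline{\mathcal{I}^{\bot_{n-2}}}\to\underline{{}^{\bot_{n-2}}\mathcal{P}}$ ($\Omega$, $\overline{\Omega}$ being syzygy and cosyzygy). The only properties used are the functorial isomorphisms, for $X\in{}^{\bot_{n-2}}\mathcal{P}$ and $Y\in\mathcal{I}^{\bot_{n-2}}$: $\operatorname{Ext}^{n-1}_{\mathcal{B}}(X,Y)\simeq D\overline{\operatorname{Hom}}_{\mathcal{B}}(Y,\tau_{n-1}X)\simeq D\underline{\operatorname{Hom}}_{\mathcal{B}}(\tau^-_{n-1}Y,X)$, and for $1\le i\le n-2$: $\operatorname{Ext}^{n-1-i}_{\mathcal{B}}(X,Y)\simeq D\operatorname{Ext}^i_{\mathcal{B}}(Y,\tau_{n-1}X)\simeq D\operatorname{Ext}^i_{\mathcal{B}}(\tau^-_{n-1}Y,X)$. Then $\tau_{n-1}$ induces an equivalence $\underline{{}^{\bot_{n-2}}\mathcal{M}}\to\overline{\mathcal{M}^{\bot_{n-2}}}$ with inverse $\tau_{n-1}^{-1}=\tau_{n-1}^-$, and it induces equivalences $\underline{\mathcal{M}}\to\overline{\overline{\Omega}\mathcal{M}}$ and ${}^{\bot_{n-2}}\mathcal{M}/[\mathcal{M}]\to\mathcal{M}^{\bot_{n-2}}/[\overline{\Omega}\mathcal{M}]$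 (the left vertical arrow). For each $M\in\mathcal{M}$ fix a short exact sequence $0\to M\to I_M\to\overline{\Omega}M\to0$ with $I_M\in\mathcal{I}$; this gives an equivalence $\overline{\Omega}:\overline{\mathcal{M}}\to\overline{\overline{\Omega}\mathcal{M}}$. The functor $\mu:\operatorname{mod}\underline{\mathcal{M}}\to\operatorname{mod}\overline{\mathcal{M}}$ is $\mu(C)=C\circ\tau_{n-1}^{-1}\circ\overline{\Omega}$. $F$ is the functor induced by $X\mapsto\operatorname{Ext}^1_{\mathcal{B}}(-,X)|_{\mathcal{M}}$, and $G$ is the functor induced by $X\mapsto\overline{\operatorname{Hom}}_{\mathcal{B}}(-,X)|_{\overline{\mathcal{M}}}$. *)

(* Defs.v *)
From HB Require Import structures.
From mathcomp Require Import all_boot all_order all_algebra.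
From mathcomp Require Import boolp.

Set Implicit Arguments.
Unset Strict Implicit.
Unset Printing Implicit Defensive.

Import GRing.Theory.
Local Open Scope ring_scope.

Section LinearAlgebra.
Variable k : fieldType.

Lemma linfun_linE (U V : vectType k) (f : U -> V) :
  linear f -> linfun f =1 f.
Proof.
move=> lf u.
pose f' : {linear U -> V} := HB.pack f (GRing.isLinear.Build _ _ _ _ f lf).
by rewrite -[RHS]/(f' u) -(lfunE f').
Qed.

Lemma span_exists (V : vectType k) (P : V -> Prop) :
  exists s : seq V, (forall v, v \in s -> P v) /\
                    (forall v, P v -> v \in <<s>>%VS).
Proof.
suff H m : forall s : seq V, (forall v, v \in s -> P v) ->
    (\dim {:V} - \dim <<s>> <= m)%N ->
    exists s : seq V, (forall v, v \in s -> P v) /\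
                      (forall v, P v -> v \in <<s>>%VS).
  exact: (H (\dim {:V} - \dim <<[::]>>%VS)%N [::]).
elim: m => [|m IH] s Ps sm.
  exists s; split=> // v _.
  have /eqP -> : (<<s>>%VS == fullv); last by rewrite memvf.
  by rewrite -(dimv_leqif_eq (subvf _)) eqn_leq dimvS ?subvf// -subn_eq0 -leqn0.
have [all_in|/existsNP[v /not_implyP[Pv /negP vs]]] :=
    pselect (forall v, P v -> v \in <<s>>%VS); first by exists s.
apply: (IH (v :: s)); first by move=> w; rewrite inE => /orP[/eqP->//|/Ps].
have sub : (<<s>> <= <<v :: s>>)%VS.
  by apply: sub_span => w ws; rewrite inE ws orbT.
have lt_s : (\dim <<s>>%VS < \dim <<v :: s>>%VS)%N.
  rewrite ltnNge; apply: contra vs => le_s.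
  have /eqP -> : (<<s>>%VS == <<v :: s>>%VS).
    by rewrite -(dimv_leqif_eq sub) eqn_leq le_s dimvS.
  by rewrite memv_span // mem_head.
move: sm; rewrite !leq_subLR addnS -addSn => sm; apply: leq_trans sm _.
by rewrite leq_add2r.
Qed.

(* The linear span of an arbitrary subset of a finite-dimensional space. *)
Definition spanv (V : vectType k) (P : V -> Prop) : {vspace V} :=
  <<projT1 (cid (span_exists P))>>%VS.

Lemma spanv_in (V : vectType k) (P : V -> Prop) v : P v -> v \in spanv P.
Proof. by rewrite /spanv; case: cid => s [/= _]; apply. Qed.

Lemma spanv_min (V : vectType k) (P : V -> Prop) (W : {vspace V}) :
  (forall v, P v -> v \in W) -> (spanv P <= W)%VS.
Proof.
rewrite /spanv; case: cid => s [/= sP _] PW.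
by apply/span_subvP => v /sP/PW.
Qed.

Lemma spanv_ind (V : vectType k) (P Q : V -> Prop) : Q 0 ->
  (forall a u v, Q u -> Q v -> Q (a *: u + v)) ->
  (forall v, P v -> Q v) -> forall v, v \in spanv P -> Q v.
Proof.
move=> Q0 QD PQ; rewrite /spanv; case: cid => s [/= sP _].
elim: s sP => [_ w|x s IH sP w]; first by rewrite span_nil memv0 => /eqP->.
rewrite span_cons => /memv_addP[y /vlineP[a ->] [z zs ->]].
apply: QD; first by apply: PQ; apply: sP; rewrite mem_head.
by apply: IH zs => t ts; apply: sP; rewrite inE ts orbT.
Qed.

Lemma spanvE (V : vectType k) (P : V -> Prop) : P 0 ->
  (forall a u v, P u -> P v -> P (a *: u + v)) ->
  forall v, v \in spanv P <-> P v.
Proof. by move=> P0 PD v; split; [exact: spanv_ind|exact: spanv_in]. Qed.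

(* V / U, realised on the chosen complement of U. *)
Definition quotv (V : vectType k) (U : {vspace V}) : vectType k :=
  subvs_of (U^C)%VS.

Definition qcls (V : vectType k) (U : {vspace V}) (v : V) : quotv U :=
  Subvs (memv_projC U v).

Definition qrep (V : vectType k) (U : {vspace V}) (q : quotv U) : V := vsval q.

Section Quotient.
Variables (V : vectType k) (U : {vspace V}).

Lemma qcls_linear : linear (@qcls V U).
Proof.
move=> a v w; apply: val_inj => /=.
by rewrite linearP /= scalerBr opprD addrACA.
Qed.

Lemma qrep_linear : linear (@qrep V U).
Proof. by move=> a v w; rewrite /qrep linearP. Qed.

Lemma qcls_eq0 v : (qcls U v = 0) <-> v \in U.
Proof.
split=> [/(congr1 val)/= /eqP|vU].
  by rewrite subr_eq0 => /eqP->; apply: memv_proj.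
by apply: val_inj => /=; rewrite projv_id // subrr.
Qed.

End Quotient.
End LinearAlgebra.

HB.instance Definition _ (k : fieldType) (V : vectType k) (U : {vspace V}) :=
  GRing.isLinear.Build k V (quotv U) _ (@qcls k V U) (@qcls_linear k V U).
HB.instance Definition _ (k : fieldType) (V : vectType k) (U : {vspace V}) :=
  GRing.isLinear.Build k (quotv U) V _ (@qrep k V U) (@qrep_linear k V U).

Section Quotient.
Variables (k : fieldType) (V : vectType k) (U : {vspace V}).

Lemma qclsP v w : (qcls U v = qcls U w) <-> v - w \in U.
Proof.
rewrite -qcls_eq0; split=> [vw|]; first by rewrite linearB /= vw subrr.
by rewrite linearB => /eqP; rewrite subr_eq0 => /eqP.
Qed.

Lemma qrepK : cancel (@qrep k V U) (@qcls k V U).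
Proof.
move=> q; apply: val_inj => /=; rewrite /qrep.
have : projv U (vsval q) = 0.
  by apply/eqP; rewrite -memv_ker lker_proj subvsP.
by move=> ->; rewrite subr0.
Qed.

Lemma qrep_cls v : qrep (qcls U v) - v \in U.
Proof. by apply/qclsP; rewrite qrepK. Qed.

End Quotient.
Arguments qcls : simpl never.
Arguments qrep : simpl never.

#[local] Obligation Tactic := idtac.
Record cat := Cat {
  ob :> Type;
  hom : ob -> ob -> Type;
  idm : forall X, hom X X;
  comp : forall X Y Z, hom Y Z -> hom X Y -> hom X Z;
  comp1m : forall X Y (f : hom X Y), comp (idm Y) f = f;
  compm1 : forall X Y (f : hom X Y), comp f (idm X) = f;
  compA : forall X Y Z T (h : hom Z T) (g : hom Y Z) (f : hom X Y),
    comp h (comp g f) = comp (comp h g) f }.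

Record functor (A B : cat) := Functor {
  fob :> A -> B;
  fmap : forall X Y : A, hom X Y -> hom (fob X) (fob Y);
  fmap1 : forall X, fmap (idm X) = idm (fob X);
  fmapM : forall X Y Z (g : hom Y Z) (f : hom X Y),
    fmap (comp g f) = comp (fmap g) (fmap f) }.

Program Definition fcomp (A B C : cat) (G : functor B C) (F : functor A B) :
    functor A C :=
  @Functor A C (fun X => G (F X)) (fun X Y f => fmap G (fmap F f)) _ _.
Next Obligation. move=> A B C G F X /=; by rewrite !fmap1. Qed.
Next Obligation. move=> A B C G F X Y Z g f /=; by rewrite !fmapM. Qed.

Definition fid (A : cat) : functor A A :=
  @Functor A A id (fun _ _ => id) (fun=> erefl) (fun _ _ _ _ _ => erefl).

Definition is_iso (A : cat) (X Y : A) (f : hom X Y) :=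
  exists g : hom Y X, comp g f = idm X /\ comp f g = idm Y.

Definition nat_iso (A B : cat) (F G : functor A B) :=
  exists a : forall X, hom (F X) (G X),
    (forall X Y (f : hom X Y), comp (a Y) (fmap F f) = comp (fmap G f) (a X)) /\
    (forall X, is_iso (a X)).

Program Definition fullcat (A : cat) (D : A -> Prop) : cat :=
  @Cat {X : A | D X} (fun X Y => hom (sval X) (sval Y))
    (fun X => idm (sval X)) (fun X Y Z g f => comp g f) _ _ _.
Next Obligation. by move=> *; exact: comp1m. Qed.
Next Obligation. by move=> *; exact: compm1. Qed.
Next Obligation. by move=> *; exact: compA. Qed.

(* A Hom-finite k-linear category. *)
Record lincat (k : fieldType) := LinCat {
  lob :> Type;
  lhom : lob -> lob -> vectType k;
  lid : forall X, lhom X X;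
  lcomp : forall X Y Z, lhom Y Z -> lhom X Y -> lhom X Z;
  lcomp1m : forall X Y (f : lhom X Y), lcomp (lid Y) f = f;
  lcompm1 : forall X Y (f : lhom X Y), lcomp f (lid X) = f;
  lcompA : forall X Y Z T (h : lhom Z T) (g : lhom Y Z) (f : lhom X Y),
    lcomp h (lcomp g f) = lcomp (lcomp h g) f;
  lcompPl : forall X Y Z (f : lhom X Y),
    linear (fun g : lhom Y Z => lcomp g f);
  lcompPr : forall X Y Z (g : lhom Y Z),
    linear (fun f : lhom X Y => lcomp g f) }.

Notation "g \oc f" := (lcomp g f) (at level 40, left associativity).

Section LinCompTheory.
Variables (k : fieldType) (A : lincat k).
Implicit Types X Y Z : A.

Let precomp X Y Z (f : lhom X Y) : {linear lhom Y Z -> lhom X Z} :=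
  HB.pack (fun g : lhom Y Z => g \oc f)
    (GRing.isLinear.Build _ _ _ _ (fun g : lhom Y Z => g \oc f) (lcompPl f)).
Let postcomp X Y Z (g : lhom Y Z) : {linear lhom X Y -> lhom X Z} :=
  HB.pack (fun f : lhom X Y => g \oc f)
    (GRing.isLinear.Build _ _ _ _ (fun f : lhom X Y => g \oc f) (lcompPr g)).

Lemma lcomp0m X Y Z (f : lhom X Y) : (0 : lhom Y Z) \oc f = 0.
Proof. exact: (linear0 (precomp Z f)). Qed.
Lemma lcompm0 X Y Z (g : lhom Y Z) : g \oc (0 : lhom X Y) = 0.
Proof. exact: (linear0 (postcomp X g)). Qed.
Lemma lcompDl X Y Z (g h : lhom Y Z) (f : lhom X Y) :
  (g + h) \oc f = g \oc f + h \oc f.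
Proof. exact: (linearD (precomp Z f)). Qed.
Lemma lcompDr X Y Z (g : lhom Y Z) (f h : lhom X Y) :
  g \oc (f + h) = g \oc f + g \oc h.
Proof. exact: (linearD (postcomp X g)). Qed.
Lemma lcompBl X Y Z (g h : lhom Y Z) (f : lhom X Y) :
  (g - h) \oc f = g \oc f - h \oc f.
Proof. exact: (linearB (precomp Z f)). Qed.
Lemma lcompBr X Y Z (g : lhom Y Z) (f h : lhom X Y) :
  g \oc (f - h) = g \oc f - g \oc h.
Proof. exact: (linearB (postcomp X g)). Qed.
Lemma lcompZl X Y Z a (g : lhom Y Z) (f : lhom X Y) :
  (a *: g) \oc f = a *: (g \oc f).
Proof. by have := lcompPl f a g 0; rewrite /= lcomp0m !addr0. Qed.
Lemma lcompZr X Y Z a (g : lhom Y Z) (f : lhom X Y) :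
  g \oc (a *: f) = a *: (g \oc f).
Proof. by have := lcompPr g a f 0; rewrite /= lcompm0 !addr0. Qed.

End LinCompTheory.

Definition cat_of (k : fieldType) (A : lincat k) : cat :=
  @Cat A (fun X Y => lhom X Y) (@lid k A) (@lcomp k A)
    (@lcomp1m k A) (@lcompm1 k A) (@lcompA k A).
Coercion cat_of : lincat >-> cat.

Record lfunctor (k : fieldType) (A B : lincat k) := LFunctor {
  lfob :> A -> B;
  lmap : forall X Y : A, lhom X Y -> lhom (lfob X) (lfob Y);
  lmap_lin : forall X Y, linear (@lmap X Y);
  lmap1 : forall X, lmap (lid X) = lid (lfob X);
  lmapM : forall X Y Z (g : lhom Y Z) (f : lhom X Y),
    lmap (g \oc f) = lmap g \oc lmap f }.

Definition functor_of (k : fieldType) (A B : lincat k) (F : lfunctor A B) :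
  functor A B := @Functor A B F (@lmap _ _ _ F) (@lmap1 _ _ _ F) (@lmapM _ _ _ F).
Coercion functor_of : lfunctor >-> functor.

Program Definition lfcomp (k : fieldType) (A B C : lincat k)
    (G : lfunctor B C) (F : lfunctor A B) : lfunctor A C :=
  @LFunctor k A C (fun X => G (F X)) (fun X Y f => lmap G (lmap F f)) _ _ _.
Next Obligation. by move=> * ? f g /=; rewrite !lmap_lin. Qed.
Next Obligation. by move=> * /=; rewrite !lmap1. Qed.
Next Obligation. by move=> * /=; rewrite !lmapM. Qed.

Definition lfid (k : fieldType) (A : lincat k) : lfunctor A A :=
  @LFunctor k A A id (fun _ _ => id) (fun _ _ _ _ _ => erefl)
    (fun=> erefl) (fun _ _ _ _ _ => erefl).

Fixpoint lfiter (k : fieldType) (A : lincat k) (m : nat) (F : lfunctor A A) :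
    lfunctor A A :=
  if m is m'.+1 then lfcomp F (lfiter m' F) else lfid A.

Program Definition full (k : fieldType) (A : lincat k) (D : A -> Prop) :
    lincat k :=
  @LinCat k {X : A | D X} (fun X Y => lhom (sval X) (sval Y))
    (fun X => lid (sval X)) (fun X Y Z g f => g \oc f) _ _ _ _ _.
Next Obligation. by move=> *; exact: lcomp1m. Qed.
Next Obligation. by move=> *; exact: lcompm1. Qed.
Next Obligation. by move=> *; exact: lcompA. Qed.
Next Obligation. by move=> *; exact: lcompPl. Qed.
Next Obligation. by move=> *; exact: lcompPr. Qed.

Definition full_incl (k : fieldType) (A : lincat k) (D : A -> Prop) :
    lfunctor (full D) A :=
  @LFunctor k (full D) A (fun X => sval X) (fun _ _ => id)
    (fun _ _ _ _ _ => erefl) (fun=> erefl) (fun _ _ _ _ _ => erefl).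

Section QuotientCategory.
Variables (k : fieldType) (A : lincat k) (C : A -> Prop).

Definition factors (X Y : A) (f : lhom X Y) :=
  exists Z (b : lhom Z Y) (a : lhom X Z), C Z /\ f = b \oc a.

(* [C](X, Y), a subspace of Hom(X, Y).  The morphisms factoring through C
   already form a subspace when C is closed under finite direct sums, see
   ideal_factors below; the span only serves to give [ideal] its type. *)
Definition ideal (X Y : A) : {vspace lhom X Y} := spanv (@factors X Y).

Lemma ideal_compl (X Y Z : A) (g : lhom Y Z) (f : lhom X Y) :
  f \in ideal X Y -> g \oc f \in ideal X Z.
Proof.
move=> fI; apply: (spanv_ind (Q := fun f => g \oc f \in ideal X Z)) fI.
- by rewrite lcompm0 mem0v.
- by move=> a u v uI vI; rewrite lcompDr lcompZr rpredD // rpredZ.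
- move=> _ [T [b [a [CT ->]]]]; apply: spanv_in.
  by exists T, (g \oc b), a; rewrite lcompA.
Qed.

Lemma ideal_compr (X Y Z : A) (g : lhom Y Z) (f : lhom X Y) :
  g \in ideal Y Z -> g \oc f \in ideal X Z.
Proof.
move=> gI; apply: (spanv_ind (Q := fun g => g \oc f \in ideal X Z)) gI.
- by rewrite lcomp0m mem0v.
- by move=> a u v uI vI; rewrite lcompDl lcompZl rpredD // rpredZ.
- move=> _ [T [b [a [CT ->]]]]; apply: spanv_in.
  by exists T, b, (a \oc f); rewrite lcompA.
Qed.

Definition cls (X Y : A) (f : lhom X Y) : quotv (ideal X Y) := qcls _ f.

Arguments cls : simpl never.

Lemma clsP (X Y : A) (f g : lhom X Y) : cls f = cls g <-> f - g \in ideal X Y.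
Proof. exact: qclsP. Qed.

Lemma cls_linear (X Y : A) : linear (@cls X Y).
Proof. exact: qcls_linear. Qed.

Definition quot_comp (X Y Z : A) (g : quotv (ideal Y Z))
  (f : quotv (ideal X Y)) : quotv (ideal X Z) := cls (qrep g \oc qrep f).

Lemma cls_comp (X Y Z : A) (g : lhom Y Z) (f : lhom X Y) :
  quot_comp (cls g) (cls f) = cls (g \oc f).
Proof.
apply/clsP.
have -> : qrep (cls g) \oc qrep (cls f) - g \oc f =
    qrep (cls g) \oc (qrep (cls f) - f) + (qrep (cls g) - g) \oc f.
  by rewrite lcompBr lcompBl addrA subrK.
by rewrite rpredD //; [apply: ideal_compl|apply: ideal_compr]; apply: qrep_cls.
Qed.

Lemma clsK (X Y : A) (q : quotv (ideal X Y)) : cls (qrep q) = q.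
Proof. exact: qrepK. Qed.

Program Definition quot : lincat k :=
  @LinCat k A (fun X Y => quotv (ideal X Y)) (fun X => cls (lid X))
    quot_comp _ _ _ _ _.
Next Obligation. by move=> X Y f /=; rewrite -(clsK f) cls_comp lcomp1m. Qed.
Next Obligation. by move=> X Y f /=; rewrite -(clsK f) cls_comp lcompm1. Qed.
Next Obligation.
move=> X Y Z T h g f /=.
by rewrite -(clsK f) -(clsK g) -(clsK h) !cls_comp lcompA.
Qed.
Next Obligation.
move=> X Y Z f a g h; rewrite /quot_comp !linearP /= lcompDl lcompZl.
exact: qcls_linear.
Qed.
Next Obligation.
move=> X Y Z f a g h; rewrite /quot_comp !linearP /= lcompDr lcompZr.
exact: qcls_linear.
Qed.

Definition quot_proj : lfunctor A quot :=
  @LFunctor k A quot id (fun X Y f => cls f) cls_linear (fun=> erefl)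
    (fun X Y Z g f => esym (cls_comp g f)).

End QuotientCategory.
Arguments cls : simpl never.

Section AdditiveNotions.
Variables (k : fieldType) (A : lincat k).

Definition liso (X Y : A) (f : lhom X Y) :=
  exists g : lhom Y X, g \oc f = lid X /\ f \oc g = lid Y.

Definition is_kernel (X Y Z : A) (i : lhom X Y) (p : lhom Y Z) :=
  p \oc i = 0 /\
  forall T (f : lhom T Y), p \oc f = 0 -> exists! h : lhom T X, i \oc h = f.

Definition is_cokernel (X Y Z : A) (p : lhom Y Z) (i : lhom X Y) :=
  p \oc i = 0 /\
  forall T (f : lhom Y T), f \oc i = 0 -> exists! h : lhom Z T, h \oc p = f.

(* The square with sides i : X -> Y, f : X -> X', i' : X' -> Y', f' : Y -> Y'. *)
Definition is_pushout (X Y X' Y' : A) (i : lhom X Y) (f : lhom X X')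
    (i' : lhom X' Y') (f' : lhom Y Y') :=
  i' \oc f = f' \oc i /\
  forall T (a : lhom X' T) (b : lhom Y T), a \oc f = b \oc i ->
    exists! c : lhom Y' T, c \oc i' = a /\ c \oc f' = b.

(* The square with sides p' : Y' -> Z', f' : Y' -> Y, p : Y -> Z, f : Z' -> Z. *)
Definition is_pullback (Y Z Y' Z' : A) (p : lhom Y Z) (f : lhom Z' Z)
    (p' : lhom Y' Z') (f' : lhom Y' Y) :=
  f \oc p' = p \oc f' /\
  forall T (a : lhom T Z') (b : lhom T Y), f \oc a = p \oc b ->
    exists! c : lhom T Y', p' \oc c = a /\ f' \oc c = b.

Definition is_biproduct (X Y S : A) (i1 : lhom X S) (i2 : lhom Y S)
    (p1 : lhom S X) (p2 : lhom S Y) :=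
  [/\ p1 \oc i1 = lid X, p2 \oc i2 = lid Y, p1 \oc i2 = 0, p2 \oc i1 = 0
    & i1 \oc p1 + i2 \oc p2 = lid S].

Definition local_end (X : A) :=
  lid X <> 0 /\ forall f : lhom X X, liso f \/ liso (lid X - f).

End AdditiveNotions.

(* A Hom-finite k-linear exact category in the sense of Quillen: additive, with
   a class of conflations X -i-> Y -p-> Z (i is then called an inflation and p
   a deflation).  The axioms are Quillen's as reduced by Keller; they are
   self-dual. *)
Record exactcat (k : fieldType) := ExactCat {
  ecat :> lincat k;
  ex_zero : exists Z : ecat, lid Z = 0;
  ex_biprod : forall X Y : ecat,
    exists S (i1 : lhom X S) (i2 : lhom Y S) (p1 : lhom S X) (p2 : lhom S Y),
      is_biproduct i1 i2 p1 p2;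
  conflation : forall X Y Z : ecat, lhom X Y -> lhom Y Z -> Prop;
  inflation := fun (X Y : ecat) (i : lhom X Y) =>
    exists Z (p : lhom Y Z), conflation i p;
  deflation := fun (Y Z : ecat) (p : lhom Y Z) =>
    exists X (i : lhom X Y), conflation i p;
  conf_ker : forall X Y Z (i : lhom X Y) (p : lhom Y Z),
    conflation i p -> is_kernel i p;
  conf_coker : forall X Y Z (i : lhom X Y) (p : lhom Y Z),
    conflation i p -> is_cokernel p i;
  conf_iso : forall X Y Z X' Y' Z' (i : lhom X Y) (p : lhom Y Z)
      (i' : lhom X' Y') (p' : lhom Y' Z')
      (a : lhom X X') (b : lhom Y Y') (c : lhom Z Z'),
    liso a -> liso b -> liso c -> b \oc i = i' \oc a -> c \oc p = p' \oc b ->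
    conflation i p -> conflation i' p';
  infl_id : forall X, inflation (lid X);
  defl_id : forall X, deflation (lid X);
  infl_comp : forall X Y Z (i : lhom X Y) (j : lhom Y Z),
    inflation i -> inflation j -> inflation (j \oc i);
  defl_comp : forall X Y Z (p : lhom X Y) (q : lhom Y Z),
    deflation p -> deflation q -> deflation (q \oc p);
  infl_pushout : forall X Y X' (i : lhom X Y) (f : lhom X X'), inflation i ->
    exists Y' (i' : lhom X' Y') (f' : lhom Y Y'),
      is_pushout i f i' f' /\ inflation i';
  defl_pullback : forall Y Z Z' (p : lhom Y Z) (f : lhom Z' Z), deflation p ->
    exists Y' (p' : lhom Y' Z') (f' : lhom Y' Y),
      is_pullback p f p' f' /\ deflation p' }.

Definition krull_schmidt (k : fieldType) (A : lincat k) :=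
  forall X : A, exists (m : nat) (Y : 'I_m -> A)
      (i : forall j, lhom (Y j) X) (p : forall j, lhom X (Y j)),
    [/\ forall j, local_end (Y j),
        forall j, p j \oc i j = lid (Y j),
        forall j l, j <> l -> p j \oc i l = 0
      & \sum_j i j \oc p j = lid X].

Section ExactCategory.
Variables (k : fieldType) (B : exactcat k).

Definition projective (P : B) :=
  forall (Y Z : B) (p : lhom Y Z) (f : lhom P Z), deflation p ->
    exists g : lhom P Y, p \oc g = f.

Definition injective (I : B) :=
  forall (X Y : B) (i : lhom X Y) (f : lhom X I), inflation i ->
    exists g : lhom Y I, g \oc i = f.

(* 0 -> syz -> pcov -> X -> 0 with pcov projective *)
Record proj_pres (X : B) := ProjPres {
  syz : B;
  pcov : B;
  syz_in : lhom syz pcov;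
  pcov_out : lhom pcov X;
  pcov_proj : projective pcov;
  proj_pres_conf : conflation syz_in pcov_out }.

(* 0 -> X -> ihull -> cosyz -> 0 with ihull injective *)
Record inj_pres (X : B) := InjPres {
  ihull : B;
  cosyz : B;
  ihull_in : lhom X ihull;
  cosyz_out : lhom ihull cosyz;
  ihull_inj : injective ihull;
  inj_pres_conf : conflation ihull_in cosyz_out }.

(* Enough projectives, as a choice of a presentation of every object; the
   functors Omega and Ext below are built from it. *)
Definition enough_projectives := forall X : B, proj_pres X.
Definition enough_injectives := forall X : B, inj_pres X.

Definition stab : lincat k := quot projective.
Definition costab : lincat k := quot injective.

Lemma conf_mono (X Y Z T : B) (i : lhom X Y) (p : lhom Y Z) (a b : lhom T X) :
  conflation i p -> i \oc a = i \oc b -> a = b.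
Proof.
move=> /conf_ker[pi0 H] iab.
have [|h [_ u]] := H T (i \oc a); first by rewrite lcompA pi0 lcomp0m.
by rewrite -(u a) // -(u b).
Qed.

Lemma conf_epi (X Y Z T : B) (i : lhom X Y) (p : lhom Y Z) (a b : lhom Z T) :
  conflation i p -> a \oc p = b \oc p -> a = b.
Proof.
move=> /conf_coker[pi0 H] iab.
have [|h [_ u]] := H T (a \oc p); first by rewrite -lcompA pi0 lcompm0.
by rewrite -(u a) // -(u b).
Qed.

Lemma ideal_factors (C : B -> Prop) :
  (forall Z, lid Z = 0 -> C Z) ->
  (forall (X Y S : B) (i1 : lhom X S) (i2 : lhom Y S) p1 p2,
     is_biproduct i1 i2 p1 p2 -> C X -> C Y -> C S) ->
  forall (X Y : B) (f : lhom X Y), f \in ideal C X Y <-> factors C f.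
Proof.
move=> C0 CD X Y; apply: spanvE.
  have [Z Z0] := ex_zero B; exists Z, 0, 0; split; first exact: C0.
  by rewrite lcomp0m.
move=> a _ _ [Z [b [c [CZ ->]]]] [Z' [b' [c' [CZ' ->]]]].
have [S [i1 [i2 [p1 [p2 H]]]]] := ex_biprod Z Z'.
have [H1 H2 H3 H4 _] := H.
exists S, (a *: (b \oc p1) + b' \oc p2), (i1 \oc c + i2 \oc c').
split; first exact: CD H CZ CZ'.
rewrite lcompDl !lcompDr !lcompZl -!lcompA (lcompA p1 i1) (lcompA p1 i2).
rewrite (lcompA p2 i1) (lcompA p2 i2) H1 H2 H3 H4 !lcomp0m !lcompm0 !lcomp1m.
by rewrite scaler0 addr0 add0r.
Qed.

Lemma projective_factors (X Y : B) (f : lhom X Y) :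
  f \in ideal projective X Y <-> factors projective f.
Proof.
apply: ideal_factors => [Z Z0|U V S i1 i2 p1 p2 [_ _ _ _ idS] PU PV].
  by move=> U V p f' _; exists 0; rewrite lcompm0 -[f']lcompm1 Z0 lcompm0.
move=> T W p f' dp.
have [g1 g1E] := PU _ _ p (f' \oc i1) dp.
have [g2 g2E] := PV _ _ p (f' \oc i2) dp.
exists (g1 \oc p1 + g2 \oc p2).
by rewrite lcompDr !lcompA g1E g2E -!lcompA -lcompDr idS lcompm1.
Qed.

Lemma injective_factors (X Y : B) (f : lhom X Y) :
  f \in ideal injective X Y <-> factors injective f.
Proof.
apply: ideal_factors => [Z Z0|U V S i1 i2 p1 p2 [_ _ _ _ idS] IU IV].
  by move=> U V i f' _; exists 0; rewrite lcomp0m -[f']lcomp1m Z0 lcomp0m.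
move=> T W i f' di.
have [g1 g1E] := IU _ _ i (p1 \oc f') di.
have [g2 g2E] := IV _ _ i (p2 \oc f') di.
exists (i1 \oc g1 + i2 \oc g2).
by rewrite lcompDl -!lcompA g1E g2E !lcompA -lcompDl idS lcomp1m.
Qed.

End ExactCategory.

Section Syzygy.
Variables (k : fieldType) (B : exactcat k) (PP : enough_projectives B).
Local Notation Om X := (syz (PP X)).
Local Notation PC X := (pcov (PP X)).
Local Notation iO X := (syz_in (PP X)).
Local Notation pO X := (pcov_out (PP X)).

Definition syz_lift (X Y : B) (f : lhom X Y) (g : lhom (Om X) (Om Y)) :=
  exists h : lhom (PC X) (PC Y), pO Y \oc h = f \oc pO X /\ iO Y \oc g = h \oc iO X.

Lemma syz_lift_exists (X Y : B) (f : lhom X Y) : exists g, syz_lift f g.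
Proof.
have cX := proj_pres_conf (PP X); have cY := proj_pres_conf (PP Y).
have [|h hE] := @pcov_proj _ _ _ (PP X) _ _ (pO Y) (f \oc pO X).
  by exists (Om Y), (iO Y).
have [|g [gE _]] := (conf_ker cY).2 _ (h \oc iO X).
  by rewrite lcompA hE -lcompA (conf_ker cX).1 lcompm0.
by exists g, h.
Qed.

Lemma syz_lift_lin (X Y : B) a (f f' : lhom X Y) g g' :
  syz_lift f g -> syz_lift f' g' -> syz_lift (a *: f + f') (a *: g + g').
Proof.
move=> [h [hE gE]] [h' [hE' gE']]; exists (a *: h + h'); split.
  by rewrite lcompDr lcompZr lcompDl lcompZl hE hE'.
by rewrite lcompDr lcompZr lcompDl lcompZl gE gE'.
Qed.

Lemma syz_liftB (X Y : B) (f f' : lhom X Y) g g' :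
  syz_lift f g -> syz_lift f' g' -> syz_lift (f - f') (g - g').
Proof.
move=> fg fg'; rewrite addrC (addrC g) -!scaleN1r.
exact: syz_lift_lin.
Qed.

Lemma syz_liftM (X Y Z : B) (f : lhom X Y) (f' : lhom Y Z) g g' :
  syz_lift f g -> syz_lift f' g' -> syz_lift (f' \oc f) (g' \oc g).
Proof.
move=> [h [hE gE]] [h' [hE' gE']]; exists (h' \oc h); split.
  by rewrite lcompA hE' -lcompA hE lcompA.
by rewrite lcompA gE' -lcompA gE lcompA.
Qed.

Lemma syz_lift1 (X : B) : syz_lift (lid X) (lid (Om X)).
Proof. by exists (lid _); rewrite !lcompm1 !lcomp1m. Qed.

Lemma syz_lift_null (X Y : B) (f : lhom X Y) g : syz_lift f g ->
  f \in ideal (@projective k B) X Y -> exists s : lhom (PC X) (Om Y), g = s \oc iO X.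
Proof.
move=> [h [hE gE]] /projective_factors[Q [b [a [PQ fE]]]].
have cY := proj_pres_conf (PP Y); have cX := proj_pres_conf (PP X).
have [|b' b'E] := PQ _ _ (pO Y) b; first by exists (Om Y), (iO Y).
have [|s [sE _]] := (conf_ker cY).2 _ (h - b' \oc a \oc pO X).
  by rewrite lcompBr hE fE !lcompA b'E subrr.
exists s; apply: (conf_mono cY); rewrite gE lcompA sE lcompBl.
by rewrite -!lcompA (conf_ker cX).1 !lcompm0 subr0.
Qed.

Lemma syz_lift_ideal (X Y : B) (f : lhom X Y) g : syz_lift f g ->
  f \in ideal (@projective k B) X Y -> g \in ideal (@projective k B) (Om X) (Om Y).
Proof.
move=> fg /(syz_lift_null fg)[s ->]; apply: ideal_compl; apply: spanv_in.
by exists (PC X), (lid _), (iO X); split; [exact: pcov_proj|rewrite lcomp1m].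
Qed.

Definition syz_map (X Y : B) (f : lhom X Y) : lhom (Om X) (Om Y) :=
  projT1 (cid (syz_lift_exists f)).

Lemma syz_mapP (X Y : B) (f : lhom X Y) : syz_lift f (syz_map f).
Proof. by rewrite /syz_map; case: cid. Qed.

Lemma cls_syz_map (X Y : B) (f f' : lhom X Y) (g : lhom (Om X) (Om Y)) :
  cls (@projective k B) f = cls (@projective k B) f' -> syz_lift f' g ->
  cls (@projective k B) (syz_map f) = cls (@projective k B) g.
Proof.
move=> /clsP ff' fg; apply/clsP.
exact: syz_lift_ideal (syz_liftB (syz_mapP f) fg) ff'.
Qed.

Program Definition Omega : lfunctor (stab B) (stab B) :=
  @LFunctor k (stab B) (stab B) (fun X => Om X)
    (fun X Y f => cls (@projective k B) (syz_map (qrep f))) _ _ _.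
Next Obligation.
move=> X Y a f g; rewrite -[RHS]cls_linear.
apply: (cls_syz_map (f' := a *: qrep f + qrep g)).
  by rewrite clsK.
by apply: syz_lift_lin; exact: syz_mapP.
Qed.
Next Obligation.
move=> X /=; apply: (cls_syz_map (f' := @lid k B X)); first by rewrite clsK.
exact: syz_lift1.
Qed.
Next Obligation.
move=> X Y Z g f /=; rewrite cls_comp.
apply: (cls_syz_map (f' := qrep g \oc qrep f)); first by rewrite clsK.
by apply: syz_liftM; exact: syz_mapP.
Qed.

End Syzygy.

Section Cosyzygy.
Variables (k : fieldType) (B : exactcat k) (IP : enough_injectives B).
Local Notation Om X := (cosyz (IP X)).
Local Notation IH X := (ihull (IP X)).
Local Notation iI X := (ihull_in (IP X)).
Local Notation pI X := (cosyz_out (IP X)).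

Definition cosyz_lift (X Y : B) (f : lhom X Y) (g : lhom (Om X) (Om Y)) :=
  exists h : lhom (IH X) (IH Y), h \oc iI X = iI Y \oc f /\ g \oc pI X = pI Y \oc h.

Lemma cosyz_lift_exists (X Y : B) (f : lhom X Y) : exists g, cosyz_lift f g.
Proof.
have cX := inj_pres_conf (IP X); have cY := inj_pres_conf (IP Y).
have [|h hE] := @ihull_inj _ _ _ (IP Y) _ _ (iI X) (iI Y \oc f).
  by exists (Om X), (pI X).
have [|g [gE _]] := (conf_coker cX).2 _ (pI Y \oc h).
  by rewrite -lcompA hE lcompA (conf_coker cY).1 lcomp0m.
by exists g, h.
Qed.

Lemma cosyz_lift_lin (X Y : B) a (f f' : lhom X Y) g g' :
  cosyz_lift f g -> cosyz_lift f' g' -> cosyz_lift (a *: f + f') (a *: g + g').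
Proof.
move=> [h [hE gE]] [h' [hE' gE']]; exists (a *: h + h'); split.
  by rewrite lcompDr lcompZr lcompDl lcompZl hE hE'.
by rewrite lcompDr lcompZr lcompDl lcompZl gE gE'.
Qed.

Lemma cosyz_liftB (X Y : B) (f f' : lhom X Y) g g' :
  cosyz_lift f g -> cosyz_lift f' g' -> cosyz_lift (f - f') (g - g').
Proof.
move=> fg fg'; rewrite addrC (addrC g) -!scaleN1r.
exact: cosyz_lift_lin.
Qed.

Lemma cosyz_liftM (X Y Z : B) (f : lhom X Y) (f' : lhom Y Z) g g' :
  cosyz_lift f g -> cosyz_lift f' g' -> cosyz_lift (f' \oc f) (g' \oc g).
Proof.
move=> [h [hE gE]] [h' [hE' gE']]; exists (h' \oc h); split.
  by rewrite -lcompA hE lcompA hE' lcompA.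
by rewrite -lcompA gE lcompA gE' lcompA.
Qed.

Lemma cosyz_lift1 (X : B) : cosyz_lift (lid X) (lid (Om X)).
Proof. by exists (lid _); rewrite !lcompm1 !lcomp1m. Qed.

Lemma cosyz_lift_ideal (X Y : B) (f : lhom X Y) g : cosyz_lift f g ->
  f \in ideal (@injective k B) X Y ->
  g \in ideal (@injective k B) (Om X) (Om Y).
Proof.
move=> [h [hE gE]] /injective_factors[Q [b [a [IQ fE]]]].
have cY := inj_pres_conf (IP Y); have cX := inj_pres_conf (IP X).
have [|a' a'E] := IQ _ _ (iI X) a; first by exists (Om X), (pI X).
have [|s [sE _]] := (conf_coker cX).2 _ (h - iI Y \oc b \oc a').
  by rewrite lcompBl hE fE -!lcompA a'E subrr.
have -> : g = pI Y \oc s.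
  apply: (conf_epi cX); rewrite gE -lcompA sE lcompBr.
  by rewrite !lcompA (conf_coker cY).1 !lcomp0m subr0.
apply: ideal_compr; apply: spanv_in.
by exists (IH Y), (pI Y), (lid _); split; [exact: ihull_inj|rewrite lcompm1].
Qed.

Definition cosyz_map (X Y : B) (f : lhom X Y) : lhom (Om X) (Om Y) :=
  projT1 (cid (cosyz_lift_exists f)).

Lemma cosyz_mapP (X Y : B) (f : lhom X Y) : cosyz_lift f (cosyz_map f).
Proof. by rewrite /cosyz_map; case: cid. Qed.

Lemma cls_cosyz_map (X Y : B) (f f' : lhom X Y) (g : lhom (Om X) (Om Y)) :
  cls (@injective k B) f = cls (@injective k B) f' -> cosyz_lift f' g ->
  cls (@injective k B) (cosyz_map f) = cls (@injective k B) g.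
Proof.
move=> /clsP ff' fg; apply/clsP.
exact: cosyz_lift_ideal (cosyz_liftB (cosyz_mapP f) fg) ff'.
Qed.

Program Definition Omegabar : lfunctor (costab B) (costab B) :=
  @LFunctor k (costab B) (costab B) (fun X => Om X)
    (fun X Y f => cls (@injective k B) (cosyz_map (qrep f))) _ _ _.
Next Obligation.
move=> X Y a f g; rewrite -[RHS]cls_linear.
apply: (cls_cosyz_map (f' := a *: qrep f + qrep g)).
  by rewrite clsK.
by apply: cosyz_lift_lin; exact: cosyz_mapP.
Qed.
Next Obligation.
move=> X /=; apply: (cls_cosyz_map (f' := @lid k B X)); first by rewrite clsK.
exact: cosyz_lift1.
Qed.
Next Obligation.
move=> X Y Z g f /=; rewrite cls_comp.
apply: (cls_cosyz_map (f' := qrep g \oc qrep f)); first by rewrite clsK.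
by apply: cosyz_liftM; exact: cosyz_mapP.
Qed.

End Cosyzygy.

Section Ext.
Variables (k : fieldType) (B : exactcat k) (PP : enough_projectives B).
Local Notation Proj := (@projective k B).
Local Notation Om X := (syz (PP X)).

Definition ext_bound (X Y : B) : {vspace lhom (Om X) Y} :=
  spanv (fun u => exists h : lhom (pcov (PP X)) Y, u = h \oc syz_in (PP X)).

Lemma ext_boundP (X Y : B) (u : lhom (Om X) Y) :
  u \in ext_bound X Y <->
  exists h : lhom (pcov (PP X)) Y, u = h \oc syz_in (PP X).
Proof.
apply: spanvE => [|a _ _ [h ->] [h' ->]]; first by exists 0; rewrite lcomp0m.
by exists (a *: h + h'); rewrite lcompDl lcompZl.
Qed.

Definition Ext1 (X Y : B) : vectType k := quotv (ext_bound X Y).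

(* Derived functors of Hom(-, Y), computed on the projective resolution with
   terms pcov (PP (Omega^j X)): for i >= 1,
     Ext i X Y = coker (Hom(pcov (Omega^(i-1) X), Y) -> Hom(Omega^i X, Y)).
   The value at i = 0 is junk and never used. *)
Definition Ext (i : nat) (X Y : B) : vectType k :=
  Ext1 (lfiter i.-1 (Omega PP) X) Y.

Definition ext1_push_fun (X Y Y' : B) (g : lhom Y Y') (e : Ext1 X Y) :
  Ext1 X Y' := qcls _ (g \oc qrep e).

Definition ext1_pull_fun (X X' Y : B) (f : lhom (X' : stab B) X)
  (e : Ext1 X Y) : Ext1 X' Y := qcls _ (qrep e \oc syz_map PP (qrep f)).

Lemma ext1_push_lin (X Y Y' : B) (g : lhom Y Y') : linear (@ext1_push_fun X _ _ g).
Proof.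
move=> a u v; rewrite /ext1_push_fun linearP /= lcompDr lcompZr.
exact: qcls_linear.
Qed.

Lemma ext1_pull_lin (X X' Y : B) (f : lhom (X' : stab B) X) :
  linear (@ext1_pull_fun _ _ Y f).
Proof.
move=> a u v; rewrite /ext1_pull_fun linearP /= lcompDl lcompZl.
exact: qcls_linear.
Qed.

Definition ext1_push (X Y Y' : B) (g : lhom Y Y') : 'Hom(Ext1 X Y, Ext1 X Y') :=
  linfun (@ext1_push_fun X _ _ g).
Definition ext1_pull (X X' Y : B) (f : lhom (X' : stab B) X) :
  'Hom(Ext1 X Y, Ext1 X' Y) := linfun (@ext1_pull_fun _ _ Y f).

Lemma ext_bound_push (X Y Y' : B) (g : lhom Y Y') u :
  u \in ext_bound X Y -> g \oc u \in ext_bound X Y'.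
Proof.
by move=> /ext_boundP[h ->]; apply/ext_boundP; exists (g \oc h); rewrite lcompA.
Qed.

Lemma ext_bound_pull (X X' Y : B) (f : lhom X' X) (g : lhom (Om X') (Om X)) u :
  syz_lift f g ->
  u \in ext_bound X Y -> u \oc g \in ext_bound X' Y.
Proof.
move=> [h [_ gE]] /ext_boundP[s ->]; apply/ext_boundP; exists (s \oc h).
by rewrite -!lcompA gE.
Qed.

Lemma ext1_pushE (X Y Y' : B) (g : lhom Y Y') u :
  ext1_push X g (qcls _ u) = qcls _ (g \oc u).
Proof.
rewrite /ext1_push linfun_linE; last exact: ext1_push_lin.
apply/qclsP; rewrite -lcompBr; apply: ext_bound_push; exact: qrep_cls.
Qed.

Lemma ext1_pullE (X X' Y : B) (f : lhom X' X) (g : lhom (Om X') (Om X)) u :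
  syz_lift f g ->
  ext1_pull Y (cls Proj f) (qcls (ext_bound X Y) u) = qcls _ (u \oc g).
Proof.
move=> fg; rewrite /ext1_pull linfun_linE; last exact: ext1_pull_lin.
apply/qclsP.
have fr := syz_mapP PP (qrep (cls Proj f)).
set v := qrep (qcls _ u); set r := syz_map _ _ in fr *.
have -> : v \oc r - u \oc g = (v - u) \oc r + u \oc (r - g).
  by rewrite lcompBl lcompBr addrA subrK.
apply: rpredD; first by apply: ext_bound_pull fr _; exact: qrep_cls.
have [|s ->] := syz_lift_null (syz_liftB fr fg); first exact: qrep_cls.
by apply/ext_boundP; exists (u \oc s); rewrite lcompA.
Qed.

(* Ext^i(f, g) : Ext^i(X, Y) -> Ext^i(X', Y') *)
Definition ext_map (i : nat) (X X' Y Y' : B) (f : lhom (X' : stab B) X)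
    (g : lhom Y Y') (e : Ext i X Y) : Ext i X' Y' :=
  ext1_push _ g (ext1_pull _ (lmap (lfiter i.-1 (Omega PP)) f) e).

Lemma ext1_push1 (X Y : B) e : ext1_push X (lid Y) e = e.
Proof. by rewrite -(qrepK e) ext1_pushE lcomp1m. Qed.

Lemma ext1_pushM (X Y Z T : B) (g : lhom Z T) (f : lhom Y Z) e :
  ext1_push X (g \oc f) e = ext1_push X g (ext1_push X f e).
Proof. by rewrite -(qrepK e) !ext1_pushE lcompA. Qed.

Lemma ext1_pull1 (X Y : B) e : ext1_pull Y (lid (X : stab B)) e = e.
Proof.
rewrite -(qrepK e); rewrite (ext1_pullE _ (syz_lift1 PP X)).
by rewrite lcompm1.
Qed.

Lemma ext1_pullM (X Y Z T : stab B) (g : lhom Y Z) (f : lhom X Y) e :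
  ext1_pull T (g \oc f) e = ext1_pull T f (ext1_pull T g e).
Proof.
rewrite -(qrepK e) -(clsK f) -(clsK g) /= cls_comp.
have fP := syz_mapP PP (qrep f); have gP := syz_mapP PP (qrep g).
by rewrite (ext1_pullE _ gP) !(ext1_pullE _ fP) (ext1_pullE _ (syz_liftM fP gP)) lcompA.
Qed.

Lemma ext1_pullD (X Y T : stab B) (f g : lhom X Y) e :
  ext1_pull T (f + g) e = ext1_pull T f e + ext1_pull T g e.
Proof.
rewrite -(qrepK e) -(clsK f) -(clsK g).
have fP := syz_mapP PP (qrep f); have gP := syz_mapP PP (qrep g).
have -> : cls Proj (qrep f) + cls Proj (qrep g) = cls Proj (1 *: qrep f + qrep g).
  by rewrite cls_linear scale1r.
rewrite (ext1_pullE _ (syz_lift_lin 1 fP gP)) (ext1_pullE _ fP) (ext1_pullE _ gP).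
by rewrite scale1r lcompDr linearD.
Qed.

Lemma ext1_push_pull (X' X Y Y' : B) (f : lhom (X' : stab B) X) (g : lhom Y Y') e :
  ext1_push X' g (ext1_pull Y f e) = ext1_pull Y' f (ext1_push X g e).
Proof.
rewrite -(qrepK e) -(clsK f); have fP := syz_mapP PP (qrep f).
by rewrite ext1_pushE !(ext1_pullE _ fP) ext1_pushE lcompA.
Qed.

End Ext.

Section Modules.
Variables (k : fieldType) (D : lincat k).

Record module := Module {
  mob :> D -> vectType k;
  mact : forall X Y : D, lhom X Y -> 'Hom(mob Y, mob X);
  mact1 : forall X a, mact (lid X) a = a;
  mactM : forall X Y Z (g : lhom Y Z) (f : lhom X Y) a,
    mact (g \oc f) a = mact f (mact g a);
  mactD : forall X Y (f g : lhom X Y) a, mact (f + g) a = mact f a + mact g a }.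

Record module_hom (A N : module) := ModuleHom {
  mhom :> forall X : D, 'Hom(A X, N X);
  mhom_nat : forall X Y (f : lhom X Y) a, mhom X (mact A f a) = mact N f (mhom Y a) }.

Lemma module_homP (A N : module) (u v : module_hom A N) :
  (forall X, u X =1 v X) -> u = v.
Proof.
move: u v => [u un] [v vn] /= uv.
have e : u = v by apply: functional_extensionality_dep => X; apply/lfunP/uv.
by subst v; congr ModuleHom; exact: Prop_irrelevance.
Qed.

Program Definition module_id (A : module) : module_hom A A :=
  @ModuleHom A A (fun X => \1%VF) _.
Next Obligation. by move=> A X Y f a; rewrite !id_lfunE. Qed.

Program Definition module_comp (A N L : module) (g : module_hom N L)
    (f : module_hom A N) : module_hom A L :=
  @ModuleHom A L (fun X => (g X \o f X)%VF) _.
Next Obligation.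
by move=> A N L g f X Y h a; rewrite !comp_lfunE !mhom_nat.
Qed.

Program Definition Mod : cat := @Cat module module_hom module_id module_comp _ _ _.
Next Obligation. by move=> A N f; apply: module_homP => X a /=; rewrite !lfunE /= ?lfunE. Qed.
Next Obligation. by move=> A N f; apply: module_homP => X a /=; rewrite !lfunE /= ?lfunE. Qed.
Next Obligation.
by move=> A N L R h g f; apply: module_homP => X a /=; rewrite !comp_lfunE.
Qed.

Definition precomp_fun (X Y Z : D) (f : lhom X Y) (g : lhom Y Z) := g \oc f.

(* Hom(-, Z) *)
Program Definition hom_module (Z : D) : module :=
  @Module (fun X => lhom X Z) (fun X Y f => linfun (@precomp_fun X Y Z f)) _ _ _.
Next Obligation.
by move=> Z X a; rewrite linfun_linE /precomp_fun ?lcompm1 //; exact: lcompPl.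
Qed.
Next Obligation.
move=> Z X Y T g f a; rewrite !linfun_linE /precomp_fun ?lcompA //; exact: lcompPl.
Qed.
Next Obligation.
move=> Z X Y f g a; rewrite !linfun_linE /precomp_fun ?lcompDr //; exact: lcompPl.
Qed.

Definition postcomp_fun (X Y Z : D) (g : lhom Y Z) (f : lhom X Y) := g \oc f.

Program Definition hom_module_map (Y Z : D) (g : lhom Y Z) :
    module_hom (hom_module Y) (hom_module Z) :=
  @ModuleHom (hom_module Y) (hom_module Z)
    (fun X => linfun (@postcomp_fun X Y Z g)) _.
Next Obligation.
move=> Y Z g X X' f h /=.
rewrite !linfun_linE; try exact: lcompPr; try exact: lcompPl.
exact: lcompA.
Qed.

Program Definition yoneda : functor D Mod :=
  @Functor D Mod hom_module (fun Y Z g => hom_module_map g) _ _.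
Next Obligation.
move=> X; apply: module_homP => Z e; rewrite [RHS]id_lfunE.
by rewrite linfun_linE; [exact: lcomp1m|exact: lcompPr].
Qed.
Next Obligation.
move=> X Y T g f; apply: module_homP => Z e; rewrite [RHS]comp_lfunE.
by rewrite !linfun_linE; try exact: lcompPr; exact/esym/lcompA.
Qed.

(* Existence of an exact sequence Hom(-, D1) -> Hom(-, D0) -> A -> 0. *)
Definition finpres (A : Mod) :=
  exists (D1 D0 : D) (u : module_hom (hom_module D1) (hom_module D0))
      (p : module_hom (hom_module D0) A), forall X,
    (forall a, exists h, p X h = a) /\
    (forall h, p X h = 0 <-> exists h1, u X h1 = h).

Definition mods : cat := fullcat finpres.

End Modules.

Section Precomposition.
Variables (k : fieldType) (A D : lincat k) (E : lfunctor A D).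

Lemma lmapD (X Y : A) (f g : lhom X Y) : lmap E (f + g) = lmap E f + lmap E g.
Proof. by rewrite -[f in LHS]scale1r lmap_lin scale1r. Qed.

Program Definition precomp_module (C : module D) : module A :=
  @Module k A (fun X => C (E X)) (fun X Y f => mact C (lmap E f)) _ _ _.
Next Obligation. by move=> C X a /=; rewrite lmap1 mact1. Qed.
Next Obligation. by move=> C X Y Z g f a /=; rewrite lmapM mactM. Qed.
Next Obligation. by move=> C X Y f g a /=; rewrite lmapD mactD. Qed.

Program Definition precomp_hom (C C' : module D) (u : module_hom C C') :
    module_hom (precomp_module C) (precomp_module C') :=
  @ModuleHom k A (precomp_module C) (precomp_module C') (fun X => u (E X)) _.
Next Obligation. by move=> C C' u X Y f a /=; rewrite mhom_nat. Qed.

Program Definition restrict : functor (Mod D) (Mod A) :=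
  @Functor (Mod D) (Mod A) precomp_module precomp_hom _ _.
Next Obligation. by move=> C; apply: module_homP. Qed.
Next Obligation. by move=> C C' C'' g f; apply: module_homP. Qed.

Definition preserves_finpres :=
  forall C : module D, finpres C -> finpres (precomp_module C).

(* C |-> C o E on finitely presented modules *)
Program Definition precomp (w : preserves_finpres) : functor (mods D) (mods A) :=
  @Functor (mods D) (mods A)
    (fun C => exist (@finpres k A) (precomp_module (sval C)) (w _ (svalP C)))
    (fun C C' u => precomp_hom u) _ _.
Next Obligation. by move=> w C; apply: module_homP. Qed.
Next Obligation. by move=> w C C' C'' g f; apply: module_homP. Qed.

End Precomposition.

Section InducedFunctors.
Variables (k : fieldType) (A : lincat k).

(* Phi : A/[C] -> A/[C'] induces a functor D1/[C1] -> D1'/[C1']. *)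
Record induces (C C' : A -> Prop) (Phi : lfunctor (quot C) (quot C'))
    (D1 C1 D1' C1' : A -> Prop) : Prop := Induces {
  induces_ob : forall X, D1 X -> D1' (Phi X);
  induces_map : forall (X Y : A) (f : lhom X Y), D1 X -> D1 Y ->
    f \in ideal C1 X Y ->
    qrep (lmap Phi (cls C f)) \in ideal C1' (Phi X : A) (Phi Y : A);
  induces_sub : forall X Y (f : lhom X Y),
    f \in ideal C' X Y -> f \in ideal C1' X Y }.

Section Restriction.
Variables (C C' : A -> Prop) (Phi : lfunctor (quot C) (quot C')).
Variables (D1 C1 D1' C1' : A -> Prop) (w : induces Phi D1 C1 D1' C1').

Definition induced_map (X Y : A) (f : quotv (ideal C1 X Y)) :
    quotv (ideal C1' (Phi X : A) (Phi Y : A)) :=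
  cls C1' (qrep (lmap Phi (cls C (qrep f)))).

(* Independence of the representatives. *)
Lemma induced_mapE (X Y : A) (f : lhom X Y) g : D1 X -> D1 Y ->
  cls C' g = lmap Phi (cls C f) -> induced_map (cls C1 f) = cls C1' g.
Proof.
move=> DX DY gE; apply/clsP.
set f' := qrep (cls C1 f); set g' := qrep _.
have ff' : f' - f \in ideal C1 X Y by exact: qrep_cls.
have := induces_map w DX DY ff'; set h := qrep _ => hI.
have -> : g' - g = h + (g' - g - h) by rewrite addrCA subrr addr0.
apply: rpredD hI _; apply: (induces_sub w); apply/clsP.
rewrite /h clsK.
have lin : cls C' (g' - g) = lmap Phi (cls C f') - lmap Phi (cls C f).
  rewrite -gE -(clsK (lmap Phi (cls C f'))) -/g'.
  by rewrite -[g' - g]addrC -scaleN1r cls_linear scaleN1r addrC.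
rewrite lin; have -> : f' - f = -1 *: f + f' by rewrite scaleN1r addrC.
by rewrite cls_linear lmap_lin scaleN1r addrC.
Qed.

Program Definition induced : lfunctor (full (A := quot C1) D1) (full (A := quot C1') D1') :=
  @LFunctor k (full (A := quot C1) D1) (full (A := quot C1') D1')
    (fun X => exist D1' (Phi (sval X)) (induces_ob w (svalP X)))
    (fun X Y f => @induced_map (sval X) (sval Y) f) _ _ _.
Next Obligation.
move=> [X DX] [Y DY] a f g /=; rewrite -(clsK f) -(clsK g).
rewrite -[X in induced_map X]cls_linear -[RHS]cls_linear.
apply: induced_mapE => //; rewrite !cls_linear lmap_lin !clsK.
by [].
Qed.
Next Obligation.
move=> [X DX] /=; apply: induced_mapE => //.
by rewrite (lmap1 Phi).
Qed.
Next Obligation.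
move=> [X DX] [Y DY] [Z DZ] g f /=; rewrite -(clsK f) -(clsK g) !cls_comp.
rewrite !clsK; apply: induced_mapE => //.
rewrite -!(cls_comp C) -[LHS]cls_comp !clsK.
exact/esym/(lmapM Phi).
Qed.

End Restriction.

(* A functor with values in modules induces D/[C] -> mod D' as soon as it is
   finitely presented on D and does not distinguish morphisms of D that are
   congruent modulo [C]. *)
Record mod_induces (D' : lincat k) (Phi : functor A (Mod D')) (D C : A -> Prop) :
    Prop := ModInduces {
  mod_induces_ob : forall X, D X -> finpres (Phi X);
  mod_induces_map : forall (X Y : A) (f g : lhom X Y), D X -> D Y ->
    f - g \in ideal C X Y ->
    fmap Phi (f : hom (X : cat_of A) Y) = fmap Phi (g : hom (X : cat_of A) Y) }.

Section ModInduced.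
Variables (D' : lincat k) (Phi : functor A (Mod D')) (D C : A -> Prop).
Hypothesis w : mod_induces Phi D C.

Program Definition mod_induced : functor (full (A := quot C) D) (mods D') :=
  @Functor (full (A := quot C) D) (mods D')
    (fun X => exist (@finpres k D') (Phi (sval X)) (mod_induces_ob w (svalP X)))
    (fun X Y f => fmap Phi (qrep f : hom (sval X : cat_of A) (sval Y))) _ _.
Next Obligation.
move=> [X DX]; apply: etrans (fmap1 Phi X).
by apply: (mod_induces_map w) => //; apply: qrep_cls.
Qed.
Next Obligation.
move=> [X DX] [Y DY] [Z DZ] g f; apply: etrans (fmapM Phi _ _).
by apply: (mod_induces_map w) => //; apply: qrep_cls.
Qed.

End ModInduced.
End InducedFunctors.

Section ClusterTilting.
Variables (k : fieldType) (B : exactcat k).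
Variable PP : enough_projectives B.
Implicit Types C M : B -> Prop.

Definition ext_vanish (i : nat) (X Y : B) := forall e : Ext PP i X Y, e = 0.

Definition lperp (m : nat) C (X : B) :=
  forall i Y, (1 <= i <= m)%N -> C Y -> ext_vanish i X Y.

Definition rperp (m : nat) C (X : B) :=
  forall i Y, (1 <= i <= m)%N -> C Y -> ext_vanish i Y X.

Definition contravariantly_finite C :=
  forall X : B, exists (Z : B) (p : lhom Z X), C Z /\
    forall Z' (f : lhom Z' X), C Z' -> exists g, f = p \oc g.

Definition covariantly_finite C :=
  forall X : B, exists (Z : B) (j : lhom X Z), C Z /\
    forall Z' (f : lhom X Z'), C Z' -> exists g, f = g \oc j.

Definition cluster_tilting (n : nat) M :=
  [/\ contravariantly_finite M, covariantly_finite M,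
      forall X, M X <-> lperp n.-1 M X
    & forall X, M X <-> rperp n.-1 M X].

(* The objects of Omegabar M. *)
Definition cosyz_class M (X : B) :=
  exists (Z I : B) (i : lhom Z I) (p : lhom I X),
    [/\ M Z, injective I & conflation i p].

(* Isomorphisms V(X, Y) ~ D W(X, Y), for X in DX and Y in DY, functorial in
   X and Y; V is contravariant in X and covariant in Y, W the opposite. *)
Definition dual_iso (DX DY : B -> Prop) (V W : B -> B -> vectType k)
    (Vmap : forall X X' Y Y', lhom X' X -> lhom Y Y' -> V X Y -> V X' Y')
    (Wmap : forall X X' Y Y', lhom X' X -> lhom Y Y' -> W X' Y' -> W X Y) :=
  exists theta : forall X Y, 'Hom(V X Y, 'Hom(W X Y, k^o)),
    (forall X Y, DX X -> DY Y -> bijective (theta X Y)) /\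
    (forall X X' Y Y' (f : lhom X' X) (g : lhom Y Y'),
       DX X -> DX X' -> DY Y -> DY Y' -> forall v w,
       theta X' Y' (Vmap X X' Y Y' f g v) w =
       theta X Y v (Wmap X X' Y Y' f g w)).

End ClusterTilting.

Section ARTranslations.
Variables (k : fieldType) (B : exactcat k).
Variables (PP : enough_projectives B) (IP : enough_injectives B).
Local Notation Proj := (@projective k B).
Local Notation Inj := (@injective k B).

(* The action of pairs of morphisms f : X' -> X, g : Y -> Y' of B on
   Ext^i(X, Y) and, for functors t : stab B -> costab B and
   s : costab B -> stab B, on costab(Y, t X), stab(s Y, X), Ext^i(Y, t X) and
   Ext^i(s Y, X). *)
Section Actions.
Variables (i : nat) (t : lfunctor (stab B) (costab B)).
Variables (s : lfunctor (costab B) (stab B)).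

Definition act_ext (X X' Y Y' : B) (f : lhom X' X) (g : lhom Y Y') :
    Ext PP i X Y -> Ext PP i X' Y' :=
  ext_map (cls Proj f) g.

Definition act_cohom (X X' Y Y' : B) (f : lhom X' X) (g : lhom Y Y')
    (h : lhom (Y' : costab B) (t X')) : lhom (Y : costab B) (t X) :=
  lmap t (cls Proj f) \oc h \oc cls Inj g.

Definition act_hom (X X' Y Y' : B) (f : lhom X' X) (g : lhom Y Y')
    (h : lhom (s Y') (X' : stab B)) : lhom (s Y) (X : stab B) :=
  (cls Proj f : lhom (X' : stab B) X) \oc h \oc lmap s (cls Inj g).

Definition act_ext_t (X X' Y Y' : B) (f : lhom X' X) (g : lhom Y Y') :
    Ext PP i Y' (t X' : B) -> Ext PP i Y (t X : B) :=
  ext_map (cls Proj g) (qrep (lmap t (cls Proj f))).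

Definition act_ext_s (X X' Y Y' : B) (f : lhom X' X) (g : lhom Y Y') :
    Ext PP i (s Y' : B) X' -> Ext PP i (s Y : B) X :=
  ext_map (lmap s (cls Inj g)) f.

End Actions.

Record AR_translation := ARTranslation {
  tau : lfunctor (stab B) (costab B);
  taum : lfunctor (costab B) (stab B);
  taumK : nat_iso (fcomp taum tau) (fid (stab B));
  tauK : nat_iso (fcomp tau taum) (fid (costab B));
  AR_duality : dual_iso (fun=> True) (fun=> True) (@act_ext 1) (@act_cohom tau);
  AR_dualitym : dual_iso (fun=> True) (fun=> True) (@act_ext 1) (@act_hom taum) }.

Section Higher.
Variables (n : nat) (T : AR_translation).

(* tau_{n-1} = tau Omega^{n-2} *)
Definition htau : lfunctor (stab B) (costab B) :=
  lfcomp (tau T) (lfiter (n - 2) (Omega PP)).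

(* tau_{n-1}^- = tau^- Omegabar^{n-2} *)
Definition htaum : lfunctor (costab B) (stab B) :=
  lfcomp (taum T) (lfiter (n - 2) (Omegabar IP)).

Local Notation PX := (lperp PP (n - 2) Proj).
Local Notation IY := (rperp PP (n - 2) Inj).

(* htau and htaum are (n-1)-AR translations between the stable categories of
   the full subcategories PX and IY. *)
Record higher_AR : Prop := HigherAR {
  htau_ob : forall X, PX X -> IY (htau X);
  htaum_ob : forall Y, IY Y -> PX (htaum Y);
  hAR_duality : dual_iso PX IY (@act_ext (n - 1)) (@act_cohom htau);
  hAR_dualitym : dual_iso PX IY (@act_ext (n - 1)) (@act_hom htaum);
  hAR_ext : forall i, (1 <= i <= n - 2)%N ->
    dual_iso PX IY (@act_ext (n - 1 - i)) (@act_ext_t i htau);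
  hAR_extm : forall i, (1 <= i <= n - 2)%N ->
    dual_iso PX IY (@act_ext (n - 1 - i)) (@act_ext_s i htaum) }.

End Higher.
End ARTranslations.

Section Diagram.
Variables (k : fieldType) (B : exactcat k).
Variables (PP : enough_projectives B) (IP : enough_injectives B).
Variable M : B -> Prop.

Definition stabM : lincat k := full (A := stab B) M.
Definition costabM : lincat k := full (A := costab B) M.

(* X |-> Ext^1(-, X) *)
Program Definition ext_module (X : B) : module (stab B) :=
  @Module k (stab B) (fun Z => Ext1 PP Z X) (fun Z Z' f => ext1_pull PP X f) _ _ _.
Next Obligation. by move=> X Z e; apply: ext1_pull1. Qed.
Next Obligation. by move=> X Z Z' Z'' g f e; apply: ext1_pullM. Qed.
Next Obligation. by move=> X Z Z' g f e; apply: ext1_pullD. Qed.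

Program Definition ext_functor : functor B (Mod (stab B)) :=
  @Functor B (Mod (stab B)) ext_module
    (fun X Y f => @ModuleHom k (stab B) (ext_module X) (ext_module Y)
       (fun Z => ext1_push PP Z f) _) _ _.
Next Obligation. by move=> X Y f Z Z' g e; apply: ext1_push_pull. Qed.
Next Obligation.
by move=> X; apply: module_homP => Z e; rewrite [RHS]id_lfunE; apply: ext1_push1.
Qed.
Next Obligation.
move=> X Y T g f; apply: module_homP => Z e; rewrite [RHS]comp_lfunE.
exact: ext1_pushM.
Qed.

(* X |-> Ext^1(-, X)|_M *)
Definition extM : functor B (Mod stabM) :=
  fcomp (restrict (full_incl (A := stab B) M)) ext_functor.

(* X |-> Hom_costab(-, X)|_M *)
Definition cohomM : functor B (Mod costabM) :=
  fcomp (restrict (full_incl (A := costab B) M))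
    (fcomp (yoneda (costab B)) (quot_proj (@injective k B))).

Variables (n : nat) (T : AR_translation PP).

(* The arrows of the square.  Each takes as argument the fact that the formula
   defining it does induce a functor between the indicated categories. *)

Definition left_wd := induces (htau n T)
  (lperp PP (n - 2) M) M (rperp PP (n - 2) M) (cosyz_class M).

Definition left_arrow (w : left_wd) :
    functor (full (A := quot M) (lperp PP (n - 2) M))
            (full (A := quot (cosyz_class M)) (rperp PP (n - 2) M)) :=
  induced w.

Definition F_wd := mod_induces extM (lperp PP (n - 2) M) M.

Definition F_arrow (w : F_wd) :
    functor (full (A := quot M) (lperp PP (n - 2) M)) (mods stabM) :=
  mod_induced w.

Definition G_wd := mod_induces cohomM (rperp PP (n - 2) M) (cosyz_class M).

Definition G_arrow (w : G_wd) :
    functor (full (A := quot (cosyz_class M)) (rperp PP (n - 2) M)) (mods costabM) :=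
  mod_induced w.

(* tau_{n-1}^- o Omegabar restricts to a functor from M/[I] to M/[P]. *)
Definition mu_base_wd := induces (lfcomp (htaum IP n T) (Omegabar IP))
  M (@injective k B) M (@projective k B).

Definition mu_base (w : mu_base_wd) : lfunctor costabM stabM := induced w.

Definition mu_arrow (w : mu_base_wd) (w' : preserves_finpres (mu_base w)) :
  functor (mods stabM) (mods costabM) := precomp w'.

End Diagram.

(* Main.v *)
From mathcomp Require Import all_boot all_order all_algebra.
From mathcomp Require Import boolp zify.
Require Import Defs.

(**
  By the higher Auslander-Reiten formulas both corners of the square are dual
  to one and the same bifunctor: for X in the left perpendicular category and
  Z in M,
    D Hom_costab(Z, tau_{n-1} X) = Ext^{n-1}(X, Z) = Ext^{n-2}(X, Omegabar Z)
      = D Ext^1(tau_{n-1}^- Omegabar Z, X)             for n >= 3,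
    D Hom_costab(Z, tau X) = Ext^1(X, Z) = Hom_costab(X, Omegabar Z)
      = Hom_stab(tau^- X, tau^- Omegabar Z)
      = D Ext^1(tau^- Omegabar Z, X)                   for n = 2.
  Instead of composing these isomorphisms, two pairings with the same space
  U = Hom(Omega^{n-2} X, Omegabar Z) are compared: both are onto the dual of
  their second argument and both have as kernel the maps that factor through
  the injective hull of Z, so they differ by a unique isomorphism of the second
  arguments, whose naturality is formal.

  Idempotents are never split: approximations are turned into inflations or
  deflations by adding an injective or a projective object, and objects are
  identified only up to direct summands, which suffices to transport finite
  presentations.
*)

Set Implicit Arguments.
Unset Strict Implicit.
Unset Printing Implicit Defensive.

Import GRing.Theory.
Local Open Scope ring_scope.

(** * Pairings *)

Section Pairings.
Variable k : fieldType.
Implicit Types U W V : vectType k.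

Lemma linear_lin_sum U V (f : U -> V) (I : finType) (a : I -> k) (x : I -> U) :
  linear f -> f (\sum_i a i *: x i) = \sum_i a i *: f (x i).
Proof.
move=> fl; rewrite -[LHS](linfun_linE fl) linear_sum /=.
by apply: eq_bigr => i _; rewrite linearZ /= linfun_linE.
Qed.

Lemma linear_linB U V (f : U -> V) x y : linear f -> f (x - y) = f x - f y.
Proof. by move=> fl; rewrite -!(linfun_linE fl) linearB. Qed.

Lemma linear_lin0 U V (f : U -> V) : linear f -> f 0 = 0.
Proof. by move=> fl; rewrite -(linfun_linE fl) linear0. Qed.

Definition dual_coord W (i : 'I_(\dim {:W})) : 'Hom(W, k^o) :=
  linfun (coord (vbasis {:W}) i : W -> k^o).

Lemma dual_coord_basis W (w : W) :
  w = \sum_i (dual_coord i w : k) *: (vbasis {:W})`_i.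
Proof.
rewrite [LHS](coord_vbasis (memvf w)).
by apply: eq_bigr => i _; rewrite lfunE.
Qed.

Lemma dual_sep W (w : W) : (forall f : 'Hom(W, k^o), f w = 0) -> w = 0.
Proof.
move=> w0; rewrite (dual_coord_basis w) big1 // => i _.
by rewrite w0 scale0r.
Qed.

Definition bilin U W (A : U -> W -> k^o) :=
  (forall w, linear (A^~ w)) /\ (forall u, linear (A u)).

(** A left kernel is allowed, because the first argument will be a Hom space not yet divided by the
    maps through an injective hull. *)
Definition onto_dual U W (A : U -> W -> k^o) :=
  forall f : 'Hom(W, k^o), exists u, forall w, A u w = f w.

Lemma onto_dual_sep U W (A : U -> W -> k^o) w w' : bilin A -> onto_dual A ->
  (forall u, A u w = A u w') -> w = w'.
Proof.
move=> [_ Al] Ao e; apply/eqP; rewrite -subr_eq0; apply/eqP/dual_sep => f.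
have [u uf] := Ao f; rewrite -uf linear_linB //.
by rewrite e subrr.
Qed.

(** [B] identifies [U] modulo its left kernel with the dual of [W']. Each form A(-, w) descends to
    that dual, hence is a vector of [W']; in coordinates it is the sum of the A(v_i, w) b_i, where
    v_i induces the i-th coordinate form. *)
Lemma pairing_transfer U W W' (A : U -> W -> k^o) (B : U -> W' -> k^o) :
  bilin A -> bilin B -> onto_dual B ->
  (forall u, (forall w, B u w = 0) -> forall w, A u w = 0) ->
  exists a : 'Hom(W, W'), forall u w, A u w = B u (a w).
Proof.
move=> [Al Ar] [Bl Br] Bo BA.
pose b := vbasis {:W'}.
have /fin_all_exists[v vE] i := Bo (dual_coord i).
pose af w : W' := \sum_(i < \dim {:W'}) (A (v i) w : k) *: b`_i.
have al : linear af.
  move=> c x y; rewrite /af scaler_sumr -big_split /=; apply: eq_bigr => i _.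
  by rewrite Ar scalerDl scalerA.
exists (linfun af) => u w; rewrite linfun_linE // /af linear_lin_sum //.
(* [u'] pairs under [B] exactly as [u] does, so [u - u'] lies in the left kernel of [B], hence in
   that of [A]. *)
pose u' := \sum_(i < \dim {:W'}) (B u b`_i : k) *: v i.
have uu' x : B (u - u') x = 0.
  rewrite (linear_linB _ _ (Bl x)) /= (linear_lin_sum _ _ (Bl x)) /=.
  rewrite {1}(dual_coord_basis x) linear_lin_sum //; apply/eqP.
  rewrite subr_eq0; apply/eqP; apply: eq_bigr => i _.
  by rewrite vE /GRing.scale /= mulrC.
have := BA _ uu' w.
rewrite (linear_linB _ _ (Al w)) /= (linear_lin_sum _ _ (Al w)) /= => /eqP.
rewrite subr_eq0 => /eqP->.
by apply: eq_bigr => i _; rewrite /GRing.scale /= mulrC.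
Qed.

(** Equal left kernels let [pairing_transfer] run in both directions; the two maps are mutually
    inverse because an onto pairing separates its second argument. *)
Lemma pairing_iso U W W' (A : U -> W -> k^o) (B : U -> W' -> k^o) :
  bilin A -> bilin B -> onto_dual A -> onto_dual B ->
  (forall u, (forall w, B u w = 0) <-> (forall w, A u w = 0)) ->
  exists a : 'Hom(W, W'), bijective a /\ forall u w, A u w = B u (a w).
Proof.
move=> bA bB Ao Bo AB.
have [|a aE] := pairing_transfer bA bB Bo; first by move=> u /AB.
have [|b bE] := pairing_transfer bB bA Ao; first by move=> u /AB.
exists a; split=> //; exists b => w.
  by apply: (onto_dual_sep bA Ao) => u; rewrite -bE -aE.
by apply: (onto_dual_sep bB Bo) => u; rewrite -aE -bE.
Qed.

(** Reflexivity of finite-dimensional spaces: transfer the pairing [f v * c] of [V] with the ground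
    field along [t]; the image of 1 represents [f]. *)
Lemma perfect_flip V W (t : 'Hom(V, 'Hom(W, k^o))) (f : 'Hom(V, k^o)) :
  bijective t -> exists w, forall v, t v w = f v.
Proof.
move=> bt; have [||||a aE] :=
  @pairing_transfer V k^o W (fun v c => f v * c) (fun v w => t v w).
- split=> [c x u v|u x v w]; first by rewrite linearP /= mulrDl -mulrA.
  by rewrite mulrDr /GRing.scale /= mulrCA.
- split=> [w x u v|u x v w]; last exact: linearP.
  by rewrite linearP add_lfunE scale_lfunE.
- by move=> g; have [s st ts] := bt; exists (s g) => w; rewrite ts.
- move=> v tv c; suff -> : v = 0 by rewrite linear0 mul0r.
  apply: (bij_inj bt); rewrite linear0; apply/lfunP => w.
  by rewrite tv lfunE.
by exists (a 1) => v; rewrite -aE mulr1.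
Qed.

End Pairings.
(** * Exact categories *)

Section ExactCategories.
Variables (k : fieldType) (B : exactcat k).
Implicit Types X Y Z W : B.

Lemma conf_factor_ker X Y Z (i : lhom X Y) (p : lhom Y Z) W (f : lhom W Y) :
  conflation i p -> p \oc f = 0 -> exists h, f = i \oc h.
Proof. by move=> /conf_ker[_ H] /H[h [hE _]]; exists h. Qed.

Lemma conf_factor_coker X Y Z (i : lhom X Y) (p : lhom Y Z) W (f : lhom Y W) :
  conflation i p -> f \oc i = 0 -> exists h, f = h \oc p.
Proof. by move=> /conf_coker[_ H] /H[h [hE _]]; exists h. Qed.

Lemma conf_comp0 X Y Z (i : lhom X Y) (p : lhom Y Z) :
  conflation i p -> p \oc i = 0.
Proof. by case/conf_ker. Qed.

Lemma liso_id X : liso (lid X).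
Proof. by exists (lid X); rewrite lcomp1m. Qed.

Lemma liso_inflation X Y (f : lhom X Y) : liso f -> inflation f.
Proof.
move=> [g [gf fg]]; have [Z [p c]] := infl_id X; exists Z, (p \oc g).
apply: (conf_iso (b := f) (liso_id X) _ (liso_id Z) _ _ c) => //.
  by exists g.
by rewrite -lcompA gf lcompm1 lcomp1m.
Qed.

Lemma liso_deflation X Y (f : lhom X Y) : liso f -> deflation f.
Proof.
move=> [g [gf fg]]; have [Z [i c]] := defl_id Y; exists Z, (g \oc i).
apply: (conf_iso (b := g) (liso_id Z) _ (liso_id Y) _ _ c).
- by exists f.
- by rewrite lcompm1.
by rewrite fg lcomp1m.
Qed.

Lemma zero_conflation Y :
  exists Z (i : lhom Z Y), lid Z = 0 /\ conflation i (lid Y).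
Proof.
have [Z [i c]] := defl_id Y; exists Z, i; split=> //.
have i0 : i = 0 by rewrite -(lcomp1m i) (conf_comp0 c).
by apply: (conf_mono c); rewrite i0 !lcomp0m.
Qed.

Lemma conflation_zero X :
  exists Z (p : lhom X Z), lid Z = 0 /\ conflation (lid X) p.
Proof.
have [Z [p c]] := infl_id X; exists Z, p; split=> //.
have p0 : p = 0 by rewrite -(lcompm1 p) (conf_comp0 c).
by apply: (conf_epi c); rewrite p0 !lcompm0.
Qed.

Lemma hom_from0 Z X (f : lhom Z X) : lid Z = 0 -> f = 0.
Proof. by move=> Z0; rewrite -(lcompm1 f) Z0 lcompm0. Qed.

Lemma biprod_sym X Y S (i1 : lhom X S) (i2 : lhom Y S) p1 p2 :
  is_biproduct i1 i2 p1 p2 -> is_biproduct i2 i1 p2 p1.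
Proof. by case=> ? ? ? ? ?; split=> //; rewrite addrC. Qed.

Lemma biprod_homP X Y S W (i1 : lhom X S) (i2 : lhom Y S) p1 p2
    (f g : lhom S W) : is_biproduct i1 i2 p1 p2 ->
  f \oc i1 = g \oc i1 -> f \oc i2 = g \oc i2 -> f = g.
Proof.
move=> [_ _ _ _ e] e1 e2.
by rewrite -(lcompm1 f) -(lcompm1 g) -e !lcompDr !lcompA e1 e2.
Qed.

Lemma biprod_cohomP X Y S W (i1 : lhom X S) (i2 : lhom Y S) p1 p2
    (f g : lhom W S) : is_biproduct i1 i2 p1 p2 ->
  p1 \oc f = p1 \oc g -> p2 \oc f = p2 \oc g -> f = g.
Proof.
move=> [_ _ _ _ e] e1 e2.
by rewrite -(lcomp1m f) -(lcomp1m g) -e !lcompDl -!lcompA e1 e2.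
Qed.

(** Pushing out [i] along the injection of X into X + V gives Y + V; the projections come from the
    universal property. *)
Lemma pushout_biprod X Y V T (i : lhom X Y) (t1 : lhom X T) (t2 : lhom V T)
    q1 q2 : inflation i -> is_biproduct t1 t2 q1 q2 ->
  exists S (j : lhom T S) (i1 : lhom Y S) p1 p2,
    [/\ is_biproduct i1 (j \oc t2) p1 p2, inflation j, j \oc t1 = i1 \oc i
      & p2 \oc j = q2].
Proof.
move=> ii bT; have [H1 H2 H3 H4 H5] := bT.
have [S [j [i1 [[sq uni] ij]]]] := infl_pushout t1 ii.
have [|p1 [[p1j p1i] _]] := uni _ (i \oc q1) (lid Y).
  by rewrite lcomp1m -lcompA H1 lcompm1.
have [|p2 [[p2j p2i] _]] := uni _ q2 (0 : lhom Y V).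
  by rewrite lcomp0m H4.
exists S, j, i1, p1, p2; split=> //; split=> //.
- by rewrite lcompA p2j.
- by rewrite lcompA p1j -lcompA H3 lcompm0.
(* The decomposition of the identity holds by uniqueness: both sides restrict to [j] and [i1]. *)
have [|c [_ uc]] := uni _ j i1; first by rewrite sq.
have e2 : lid S \oc j = j /\ lid S \oc i1 = i1 by rewrite !lcomp1m.
rewrite -(uc _ e2); symmetry; apply: uc; split; last first.
  by rewrite lcompDl -!lcompA p1i p2i !lcompm0 addr0 lcompm1.
rewrite lcompDl -!lcompA p1j p2j.
apply: (biprod_homP bT); rewrite lcompDl -!lcompA.
  by rewrite H1 H4 !lcompm0 addr0 lcompm1 sq.
by rewrite H3 H2 !lcompm0 add0r lcompm1.
Qed.

Lemma pullback_biprod X Y V T (p : lhom Y X) (q1 : lhom T X) (q2 : lhom T V)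
    t1 t2 : deflation p -> is_biproduct t1 t2 q1 q2 ->
  exists S (r : lhom S T) (p1 : lhom S Y) i1 i2,
    [/\ is_biproduct i1 i2 p1 (q2 \oc r), deflation r, q1 \oc r = p \oc p1
      & r \oc i2 = t2].
Proof.
move=> dp bT; have [H1 H2 H3 H4 H5] := bT.
have [S [r [p1 [[sq uni] dr]]]] := defl_pullback q1 dp.
have [|i1 [[p1i p1j] _]] := uni _ (t1 \oc p) (lid Y).
  by rewrite lcompm1 lcompA H1 lcomp1m.
have [|i2 [[p2i p2j] _]] := uni _ t2 (0 : lhom V Y).
  by rewrite lcompm0 H3.
exists S, r, p1, i1, i2; split=> //; split=> //.
- by rewrite -lcompA p2i.
- by rewrite -lcompA p1i lcompA H4 lcomp0m.
have [|c [_ uc]] := uni _ r p1; first by rewrite sq.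
have e2 : r \oc lid S = r /\ p1 \oc lid S = p1 by rewrite !lcompm1.
rewrite -(uc _ e2); symmetry; apply: uc; split; last first.
  by rewrite lcompDr !lcompA p1j p2j !lcomp0m addr0 lcomp1m.
rewrite lcompDr !lcompA p1i p2i.
apply: (biprod_cohomP bT); rewrite lcompDr !lcompA.
  by rewrite H1 H3 !lcomp0m addr0 lcomp1m sq.
by rewrite H4 H2 !lcomp0m add0r lcomp1m.
Qed.

(** The added term squares to zero, so changing its sign gives the inverse. *)
Lemma shear_liso X Y S (i1 : lhom X S) (i2 : lhom Y S) p1 p2 (f : lhom X Y) :
  is_biproduct i1 i2 p1 p2 -> liso (lid S + i2 \oc f \oc p1).
Proof.
move=> [H1 H2 H3 H4 H5]; exists (lid S - i2 \oc f \oc p1).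
have sq0 : i2 \oc f \oc p1 \oc (i2 \oc f \oc p1) = 0.
  by rewrite -!lcompA (lcompA p1 i2) H3 lcomp0m !lcompm0.
split.
  by rewrite lcompBl lcomp1m lcompDr lcompm1 sq0 addr0 addrK.
by rewrite lcompDl lcomp1m lcompBr lcompm1 sq0 subr0 subrK.
Qed.

(** The inflation is a pushout of 0 -> Y along 0 -> X, the deflation a pullback of Y -> 0 along X ->
    0. *)
Lemma split_biprod X Y : exists S (i1 : lhom X S) (i2 : lhom Y S) p1 p2,
  [/\ is_biproduct i1 i2 p1 p2, inflation i1 & deflation p1].
Proof.
have [Z [i [Z0 c]]] := zero_conflation Y.
have bX : is_biproduct (0 : lhom Z X) (lid X) (0 : lhom X Z) (lid X).
  split; rewrite ?lcompm0 ?lcomp0m ?lcompm1 ?add0r //.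
have ii : inflation i by exists Y, (lid Y).
have [S [j [i1 [p1 [p2 [bS ij _ _]]]]]] := pushout_biprod ii bX.
move: (biprod_sym bS); rewrite lcompm1 => bS'.
exists S, j, i1, p2, p1; split=> //.
have [Z' [p [Z0' c']]] := conflation_zero Y.
have bX' : is_biproduct (0 : lhom Z' X) (lid X) (0 : lhom X Z') (lid X).
  split; rewrite ?lcompm0 ?lcomp0m ?lcompm1 ?add0r //.
have dp : deflation p by exists Y, (lid Y).
have [S' [r [r1 [r2 [r3 [bS2 dr _ _]]]]]] := pullback_biprod dp bX'.
move: (biprod_sym bS2); rewrite lcomp1m => -[h1 h2 h3 h4 h5].
case: bS' => e1 e2 e3 e4 e5.
(* [r] starts from another biproduct of the same two objects; the isomorphism between the biproducts
   turns it into [p2]. *)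
have -> : p2 = r \oc (r3 \oc p2 + r2 \oc p1).
  by rewrite lcompDr !lcompA h1 h3 lcomp1m lcomp0m addr0.
apply: defl_comp dr; apply: liso_deflation.
exists (j \oc r + i1 \oc r1); split.
  rewrite lcompDl !lcompDr -!lcompA (lcompA r r3) (lcompA r r2) (lcompA r1 r3).
  rewrite (lcompA r1 r2) h1 h2 h3 h4 !lcomp0m !lcompm0 !lcomp1m addr0 add0r.
  exact: e5.
rewrite lcompDl !lcompDr -!lcompA (lcompA p2 j) (lcompA p2 i1) (lcompA p1 j).
by rewrite (lcompA p1 i1) e1 e2 e3 e4 !lcomp0m !lcompm0 !lcomp1m addr0 add0r.
Qed.

(** The map (i, f) is the inclusion of X into X + V, then the shear along [f], then a pushout of
    [i]; each is an inflation. [biprod_deflation] is dual. *)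
Lemma biprod_inflation X Y V (i : lhom X Y) (f : lhom X V) : inflation i ->
  exists S (i1 : lhom Y S) (i2 : lhom V S) p1 p2,
    is_biproduct i1 i2 p1 p2 /\ inflation (i1 \oc i + i2 \oc f).
Proof.
move=> ii; have [T [t1 [t2 [q1 [q2 [bT it _]]]]]] := split_biprod X V.
have [S [j [i1 [p1 [p2 [bS ij ji _]]]]]] := pushout_biprod ii bT.
exists S, i1, (j \oc t2), p1, p2; split=> //.
have -> : i1 \oc i + j \oc t2 \oc f = j \oc ((lid T + t2 \oc f \oc q1) \oc t1).
  have [q1t _ _ _ _] := bT.
  by rewrite lcompDl lcomp1m lcompDr ji -!lcompA q1t lcompm1.
apply: infl_comp ij; apply: infl_comp it _.
exact/liso_inflation/(shear_liso _ bT).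
Qed.

Lemma biprod_deflation X Y V (p : lhom Y X) (f : lhom V X) : deflation p ->
  exists S (i1 : lhom Y S) (i2 : lhom V S) p1 p2,
    is_biproduct i1 i2 p1 p2 /\ deflation (p \oc p1 + f \oc p2).
Proof.
move=> dp; have [T [t1 [t2 [q1 [q2 [bT _ dq]]]]]] := split_biprod X V.
have [S [r [p1 [i1 [i2 [bS dr rp _]]]]]] := pullback_biprod dp bT.
exists S, i1, i2, p1, (q2 \oc r); split=> //.
have -> : p \oc p1 + f \oc (q2 \oc r) = q1 \oc (lid T + t1 \oc f \oc q2) \oc r.
  have [q1t _ _ _ _] := bT.
  by rewrite lcompDr lcompm1 lcompDl rp !lcompA q1t lcomp1m.
apply: defl_comp dr _; apply: defl_comp dq.
exact/liso_deflation/(shear_liso _ (biprod_sym bT)).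
Qed.

Lemma injective_biprod X Y S (i1 : lhom X S) (i2 : lhom Y S) p1 p2 :
  is_biproduct i1 i2 p1 p2 -> injective X -> injective Y -> injective S.
Proof.
move=> [_ _ _ _ e] PX PY V W p f dp.
have [g1 g1E] := PX _ _ p (p1 \oc f) dp.
have [g2 g2E] := PY _ _ p (p2 \oc f) dp.
exists (i1 \oc g1 + i2 \oc g2).
by rewrite lcompDl -!lcompA g1E g2E !lcompA -lcompDl e lcomp1m.
Qed.

End ExactCategories.

(** * Extension groups *)

Section Extensions.
Variables (k : fieldType) (B : exactcat k) (PP : enough_projectives B).
Local Notation Proj := (@projective k B).
Local Notation Om X := (syz (PP X)).
Local Notation PC X := (pcov (PP X)).
Local Notation iO X := (syz_in (PP X)).
Local Notation pO X := (pcov_out (PP X)).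
Local Notation cO X := (proj_pres_conf (PP X)).
Implicit Types X Y Z W N K E C : B.

Definition syzn (m : nat) (X : B) : B := lfiter m (Omega PP) X.

(* Ext^1(N, Y) = 0, see [ext_vanishE]. *)
Definition extendable N Y :=
  forall u : lhom (Om N) Y, exists h : lhom (PC N) Y, u = h \oc iO N.

Lemma qcls_ext0 N Y (u : lhom (Om N) Y) :
  qcls (ext_bound PP N Y) u = 0 <-> exists h : lhom (PC N) Y, u = h \oc iO N.
Proof. by rewrite qcls_eq0; exact: ext_boundP. Qed.

Lemma qcls_ext_eq N Y (u v : lhom (Om N) Y) (h : lhom (PC N) Y) :
  u - v = h \oc iO N -> qcls (ext_bound PP N Y) u = qcls (ext_bound PP N Y) v.
Proof. by move=> e; apply/qclsP/ext_boundP; exists h. Qed.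

Lemma ext_vanishE i X Y : ext_vanish PP i.+1 X Y <-> extendable (syzn i X) Y.
Proof.
split=> [v u|v e]; last by rewrite -(qrepK e); apply/qcls_ext0/v.
exact/qcls_ext0/(v (qcls _ u)).
Qed.

Lemma defl_pO X : deflation (pO X).
Proof. by exists (Om X), (iO X); exact: (cO X). Qed.

Lemma pO_lift X Y Z (p : lhom Y Z) (f : lhom (PC X) Z) :
  deflation p -> exists g, f = p \oc g.
Proof. by move=> dp; have [g <-] := pcov_proj f dp; exists g. Qed.

Section Conflation.
Variables (K E W : B) (i : lhom K E) (p : lhom E W).
Hypothesis c : conflation i p.

Let dp : deflation p. Proof. by exists K, i. Qed.

(** With the lemmas that follow, this gives the exactness of the long sequence of Hom(N, -), phrased
    by factorisations; here at Ext^1(N, K). *)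
Lemma extendable_ker N : (forall f : lhom N W, exists g, f = p \oc g) ->
  extendable N E -> extendable N K.
Proof.
move=> H NE u; have [h hE] := NE (i \oc u).
have [|f fE] := conf_factor_coker (f := p \oc h) (cO N).
  by rewrite -lcompA -hE lcompA (conf_comp0 c) lcomp0m.
have [g gE] := H f.
have [|s sE] := conf_factor_ker (f := h - g \oc pO N) c.
  by rewrite lcompBr lcompA fE gE subrr.
exists s; apply: (conf_mono c); rewrite lcompA -sE lcompBl -lcompA.
by rewrite (conf_comp0 (cO N)) lcompm0 subr0.
Qed.

Lemma extendable_lift N : extendable N K ->
  forall f : lhom N W, exists g, f = p \oc g.
Proof.
move=> NK f; have [h hE] := pO_lift (f \oc pO N) dp.
have [|u uE] := conf_factor_ker (f := h \oc iO N) c.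
  by rewrite lcompA -hE -lcompA (conf_comp0 (cO N)) lcompm0.
have [s sE] := NK u.
have [|g gE] := conf_factor_coker (f := h - i \oc s) (cO N).
  by rewrite lcompBl uE sE lcompA subrr.
exists g; apply: (conf_epi (cO N)).
by rewrite -lcompA -gE lcompBr lcompA (conf_comp0 c) lcomp0m subr0.
Qed.

(** The map extends to the projective object [PC N], and from there it lifts along [p]. *)
Lemma extendable_syz_lift N : extendable N W ->
  forall f : lhom (Om N) W, exists g, f = p \oc g.
Proof.
move=> NW f; have [r ->] := NW f; have [h ->] := pO_lift r dp.
by exists (h \oc iO N); rewrite lcompA.
Qed.

Lemma extendable_syz_ker N : extendable N W -> extendable (Om N) E ->
  extendable (Om N) K.
Proof. by move=> NW; apply: extendable_ker; exact: extendable_syz_lift. Qed.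

Lemma extendable_coker N : extendable N E -> extendable (Om N) K ->
  extendable N W.
Proof.
move=> NE NK u; have [g ->] := extendable_lift NK u.
by have [h ->] := NE g; exists (p \oc h); rewrite lcompA.
Qed.

End Conflation.

Lemma extendable_inj N I : injective I -> extendable N I.
Proof.
move=> II u; have [|h <-] := II _ _ (iO N) u; last by exists h.
by exists N, (pO N); exact: (cO N).
Qed.

Lemma extendable_biprod N X Y S (i1 : lhom X S) (i2 : lhom Y S) p1 p2 :
  is_biproduct i1 i2 p1 p2 -> extendable N X -> extendable N Y ->
  extendable N S.
Proof.
move=> [_ _ _ _ e] NX NY u.
have [g1 e1] := NX (p1 \oc u); have [g2 e2] := NY (p2 \oc u).
exists (i1 \oc g1 + i2 \oc g2).
by rewrite lcompDl -!lcompA -e1 -e2 !lcompA -lcompDl e lcomp1m.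
Qed.

Lemma proj_split P : projective P -> exists (s : lhom P (PC P)) r,
  [/\ pO P \oc s = lid P & r \oc iO P = lid (Om P)].
Proof.
move=> PP_; have [s sE] := PP_ _ _ _ (lid P) (defl_pO P).
have [|r rE] := conf_factor_ker (f := lid _ - s \oc pO P) (cO P).
  by rewrite lcompBr lcompm1 lcompA sE lcomp1m subrr.
exists s, r; split=> //; apply: (conf_mono (cO P)).
rewrite lcompA -rE lcompBl -lcompA (conf_comp0 (cO P)) lcompm0 subr0.
by rewrite lcomp1m lcompm1.
Qed.

Lemma projective_syzn m P : projective P -> projective (syzn m P).
Proof.
move=> PP_; elim: m => //= m IH Y Z p f dp.
have [s [r [_ re]]] := proj_split IH.
have [g gE] := pO_lift (f \oc r) dp.
by exists (g \oc iO _); rewrite lcompA -gE -lcompA re lcompm1.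
Qed.

Lemma extendable_proj P Y : projective P -> extendable P Y.
Proof.
move=> PP_ u; have [s [r [_ re]]] := proj_split PP_.
by exists (u \oc r); rewrite -lcompA re lcompm1.
Qed.

Lemma ext_vanish_proj i P Y : (0 < i)%N -> projective P ->
  ext_vanish PP i P Y.
Proof.
case: i => // i _ PP_.
by apply/ext_vanishE/extendable_proj; exact: projective_syzn.
Qed.

Lemma ext_vanish_inj i X I : (0 < i)%N -> injective I ->
  ext_vanish PP i X I.
Proof. by case: i => // i _ II; apply/ext_vanishE/extendable_inj. Qed.

(* The class [qcls _ w] in Ext^1(C, X) of the conflation (j, q). *)
Definition conn X E C (j : lhom X E) (q : lhom E C) (w : lhom (Om C) X) :=
  exists t : lhom (PC C) E, q \oc t = pO C /\ j \oc w = t \oc iO C.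

Lemma conn_exists X E C (j : lhom X E) (q : lhom E C) :
  conflation j q -> exists w, conn j q w.
Proof.
move=> c; have [|t tE] := pO_lift (pO C) (p := q); first by exists X, j.
have [|w wE] := conf_factor_ker (f := t \oc iO C) c.
  by rewrite lcompA -tE (conf_comp0 (cO C)).
by exists w, t.
Qed.

(** Exactness at Hom(Z, C), the connecting map being the pullback of the class of the conflation;
    [conn_onto] is exactness at Ext^1(Z, X). *)
Lemma conn_pull0 X E C (j : lhom X E) (q : lhom E C) w Z (h : lhom Z C) :
  conflation j q -> conn j q w ->
  ext1_pull PP X (cls Proj h) (qcls (ext_bound PP C X) w) = 0 <->
  exists h1, h = q \oc h1.
Proof.
move=> c [t [tE wE]]; have [g [hh [hhE gE]]] := syz_lift_exists PP h.
have L : syz_lift h g by exists hh.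
rewrite (ext1_pullE _ L) qcls_ext0; split=> [[s sE]|[h1 h1E]].
  have [|h1 h1E] := conf_factor_coker (f := t \oc hh - j \oc s) (cO Z).
    by rewrite lcompBl -lcompA -gE lcompA -wE -!lcompA sE subrr.
  exists h1; apply: (conf_epi (cO Z)).
  rewrite -lcompA -h1E lcompBr !lcompA tE (conf_comp0 c) lcomp0m subr0.
  by rewrite hhE.
have [|s sE] := conf_factor_ker (f := t \oc hh - h1 \oc pO Z) c.
  by rewrite lcompBr !lcompA tE hhE h1E subrr.
exists s; apply: (conf_mono c); rewrite !lcompA wE -sE lcompBl -!lcompA gE.
by rewrite (conf_comp0 (cO Z)) lcompm0 subr0.
Qed.

Lemma conn_onto X E C (j : lhom X E) (q : lhom E C) w Z (e : Ext1 PP Z X) :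
  conflation j q -> conn j q w -> ext1_push PP Z j e = 0 ->
  exists h, ext1_pull PP X (cls Proj h) (qcls (ext_bound PP C X) w) = e.
Proof.
move=> c [t [tE wE]]; rewrite -(qrepK e); move: (qrep e) => u.
rewrite ext1_pushE qcls_ext0 => -[f fE].
have [|h hE] := conf_factor_coker (f := q \oc f) (cO Z).
  by rewrite -lcompA -fE lcompA (conf_comp0 c) lcomp0m.
have [g [hh [hhE gE]]] := syz_lift_exists PP h.
have L : syz_lift h g by exists hh.
exists h; rewrite (ext1_pullE _ L).
have [|s sE] := conf_factor_ker (f := t \oc hh - f) c.
  by rewrite lcompBr lcompA tE hhE hE subrr.
apply: (qcls_ext_eq (h := s)); apply: (conf_mono c).
by rewrite lcompBr !lcompA wE -sE lcompBl -!lcompA gE fE.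
Qed.

Lemma conn_nat X E C (j : lhom X E) (q : lhom E C) w
    X' E' C' (j' : lhom X' E') (q' : lhom E' C') w'
    (a : lhom X X') (b : lhom E E') (c : lhom C C') :
  conflation j' q' -> conn j q w -> conn j' q' w' ->
  b \oc j = j' \oc a -> c \oc q = q' \oc b ->
  ext1_push PP C a (qcls (ext_bound PP C X) w) =
  ext1_pull PP X' (cls Proj c) (qcls (ext_bound PP C' X') w').
Proof.
move=> cf [t [tE wE]] [t' [tE' wE']] sq1 sq2.
have [g [hh [hhE gE]]] := syz_lift_exists PP c.
have L : syz_lift c g by exists hh.
rewrite ext1_pushE (ext1_pullE _ L).
(* Both maps lift [c \oc pO C] along [q'], so they differ by a map into [X'], which bounds the
   difference of the two classes. *)
have [|s sE] := conf_factor_ker (f := b \oc t - t' \oc hh) cf.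
  by rewrite lcompBr !lcompA -sq2 -lcompA tE tE' hhE subrr.
apply: (qcls_ext_eq (h := s)); apply: (conf_mono cf).
rewrite lcompBr !lcompA -sq1 wE' -sE lcompBl -!lcompA wE gE.
by rewrite !lcompA.
Qed.

End Extensions.

(** * Full faithfulness of the translations *)

Lemma equivalence_full_faithful (A A' : cat) (F : functor A A') (G : functor A' A) :
  nat_iso (fcomp G F) (fid A) -> nat_iso (fcomp F G) (fid A') ->
  (forall (X Y : A) (f g : hom X Y), fmap F f = fmap F g -> f = g) /\
  (forall (X Y : A) (h : hom (F X) (F Y)), exists f, fmap F f = h).
Proof.
have faithful (C C' : cat) (F1 : functor C C') (G1 : functor C' C) :
    nat_iso (fcomp G1 F1) (fid C) ->
    forall (X Y : C) (f g : hom X Y), fmap F1 f = fmap F1 g -> f = g.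
  move=> [a [an ai]] X Y f g fg.
  have [b [_ ab]] := ai X.
  have e (u : hom X Y) : u = comp (comp (a Y) (fmap G1 (fmap F1 u))) b.
    by rewrite (an _ _ u) /= -compA ab compm1.
  by rewrite (e f) (e g) fg.
move=> GF FG; split=> [|X Y h]; first exact: faithful GF.
have [a [an ai]] := GF; have [b [ba ab]] := ai X.
have [b' [ba' ab']] := ai Y.
pose f : hom X Y := comp (comp (a Y) (fmap G h)) b.
(* [G] is faithful as well, so the equation may be checked after applying [G]. *)
exists f; apply: (faithful _ _ _ _ FG).
have e : comp (a Y) (fmap G (fmap F f)) = comp (a Y) (fmap G h).
  by rewrite [LHS](an _ _ f) /= /f -(compA _ b (a X)) ba compm1.
by rewrite -[LHS]comp1m -[RHS]comp1m -ba' -!compA e.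
Qed.

Section FullFaithful.
Variable k : fieldType.

(** Stated for one pair of objects, because syzygies and cosyzygies are fully faithful only where
    certain Ext groups vanish. *)
Definition ff_at (A A' : lincat k) (F : lfunctor A A') (X Y : A) :=
  (forall f : lhom X Y, lmap F f = 0 -> f = 0) /\
  (forall h : lhom (F X) (F Y), exists f, lmap F f = h).

Lemma ff_comp (A A' A'' : lincat k) (F : lfunctor A A') (G : lfunctor A' A'')
    X Y : ff_at F X Y -> ff_at G (F X) (F Y) -> ff_at (lfcomp G F) X Y.
Proof.
move=> [F1 F2] [G1 G2]; split=> [f /G1/F1//|h].
by have [g <-] := G2 h; have [f <-] := F2 g; exists f.
Qed.

Lemma lmap0 (A A' : lincat k) (F : lfunctor A A') (X Y : A) :
  lmap F (0 : lhom X Y) = 0.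
Proof. exact/linear_lin0/lmap_lin. Qed.

Lemma lmapB (A A' : lincat k) (F : lfunctor A A') (X Y : A) (f g : lhom X Y) :
  lmap F (f - g) = lmap F f - lmap F g.
Proof. exact/linear_linB/lmap_lin. Qed.

Lemma ff_inj (A A' : lincat k) (F : lfunctor A A') (X Y : A) (f g : lhom X Y) :
  ff_at F X Y -> lmap F f = lmap F g -> f = g.
Proof.
move=> [F1 _] e; apply/eqP; rewrite -subr_eq0; apply/eqP/F1.
by rewrite lmapB e subrr.
Qed.

Lemma cls_eq0 (A : lincat k) (C : A -> Prop) (X Y : A) (f : lhom X Y) :
  cls C f = 0 <-> f \in ideal C X Y.
Proof. exact: qcls_eq0. Qed.

Lemma ideal_through (A : lincat k) (C : A -> Prop) (X Y Z : A)
  (b : lhom Z Y) (a : lhom X Z) : C Z -> b \oc a \in ideal C X Y.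
Proof. by move=> CZ; apply: spanv_in; exists Z, b, a. Qed.

Lemma ideal_sub (A : lincat k) (C C' : A -> Prop) (X Y : A) (f : lhom X Y) :
  (forall Z, C Z -> C' Z) -> f \in ideal C X Y -> f \in ideal C' X Y.
Proof.
move=> CC'; apply/subvP/spanv_min => _ [Z [b [a [CZ ->]]]].
by apply: ideal_through; exact: CC'.
Qed.

Lemma quot_lift (A : lincat k) (C : A -> Prop) (X Y : A)
  (f : lhom (X : quot C) Y) : exists g : lhom X Y, f = cls C g.
Proof. by exists (qrep f); rewrite clsK. Qed.

Lemma cls0 (A : lincat k) (C : A -> Prop) (X Y : A) : cls C (0 : lhom X Y) = 0.
Proof. exact/linear_lin0/cls_linear. Qed.

Lemma clsD (A : lincat k) (C : A -> Prop) (X Y : A) (f g : lhom X Y) :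
  cls C (f + g) = cls C f + cls C g.
Proof. by have := cls_linear C 1 f g; rewrite !scale1r. Qed.

Variables (B : exactcat k) (PP : enough_projectives B) (IP : enough_injectives B).
Local Notation Proj := (@projective k B).
Local Notation Inj := (@injective k B).
Local Notation Om X := (syz (PP X)).
Local Notation PC X := (pcov (PP X)).
Local Notation iO X := (syz_in (PP X)).
Local Notation pO X := (pcov_out (PP X)).
Local Notation cO X := (proj_pres_conf (PP X)).
Local Notation Cs X := (cosyz (IP X)).
Local Notation Ih X := (ihull (IP X)).
Local Notation iI X := (ihull_in (IP X)).
Local Notation pI X := (cosyz_out (IP X)).
Local Notation cI X := (inj_pres_conf (IP X)).
Implicit Types X Y N J : B.

Lemma infl_iI X : inflation (iI X).
Proof. by exists (Cs X), (pI X); exact: (cI X). Qed.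

Lemma iI_extend X Y J (i : lhom X Y) (f : lhom X J) : injective J ->
  inflation i -> exists g, f = g \oc i.
Proof. by move=> JI ii; have [g <-] := JI _ _ i f ii; exists g. Qed.

(** When Ext^1(X, P) = 0 for projective P, maps from [Om X] to projectives extend to [PC X]. Thus
    maps of syzygies extend to the presentations, and factorisations through projectives can be
    subtracted there. *)
Lemma Omega_ff X Y : (forall P, projective P -> extendable PP X P) ->
  ff_at (Omega PP) (X : stab B) (Y : stab B).
Proof.
move=> XP; split=> [f|h].
  have [f0 ->] := quot_lift f => f0E.
  have [h [hE gE]] := syz_mapP PP (qrep (cls Proj f0)).
  move: f0E; rewrite /= => /cls_eq0/projective_factors[Q [b [a [QP fE]]]].
  rewrite -(clsK (cls Proj f0)); move: (qrep _) h hE gE fE => f1 h hE gE fE.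
  have [a' aE] := XP _ QP a.
  have [|r rE] := conf_factor_coker (f := h - iO Y \oc b \oc a') (cO X).
    by rewrite lcompBl -gE fE aE !lcompA subrr.
  have -> : f1 = pO Y \oc r.
    apply: (conf_epi (cO X)); rewrite -lcompA -rE lcompBr hE !lcompA.
    by rewrite (conf_comp0 (cO Y)) !lcomp0m subr0.
  by apply/cls_eq0/ideal_through; exact: pcov_proj.
have [g ->] := quot_lift h.
have [h1 h1E] := XP _ (@pcov_proj _ _ _ (PP Y)) (iO Y \oc g).
have [|f fE] := conf_factor_coker (f := pO Y \oc h1) (cO X).
  by rewrite -lcompA -h1E lcompA (conf_comp0 (cO Y)) lcomp0m.
exists (cls Proj f); apply: (cls_syz_map (f' := f)); first by rewrite clsK.
by exists h1.
Qed.

(** Dual argument with a condition on the target: maps from injectives to [Cs Y] lift to [Ih Y]. *)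
Lemma Omegabar_ff X Y : (forall J, injective J -> extendable PP J Y) ->
  ff_at (Omegabar IP) (X : costab B) (Y : costab B).
Proof.
move=> YJ; split=> [f|h].
  have [f0 ->] := quot_lift f => f0E.
  have [h [hE gE]] := cosyz_mapP IP (qrep (cls Inj f0)).
  move: f0E; rewrite /= => /cls_eq0/injective_factors[Q [b [a [QJ fE]]]].
  rewrite -(clsK (cls Inj f0)); move: (qrep _) h hE gE fE => f1 h hE gE fE.
  have [b' bE] := extendable_lift (cI Y) (YJ _ QJ) b.
  have [|r rE] := conf_factor_ker (f := h - b' \oc a \oc pI X) (cI Y).
    by rewrite lcompBr -gE fE bE !lcompA subrr.
  have -> : f1 = r \oc iI X.
    apply: (conf_mono (cI Y)); rewrite lcompA -rE lcompBl hE -!lcompA.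
    by rewrite (conf_comp0 (cI X)) !lcompm0 subr0.
  by apply/cls_eq0/ideal_through; exact: ihull_inj.
have [g ->] := quot_lift h.
have [h1 h1E] := extendable_lift (cI Y) (YJ _ (@ihull_inj _ _ _ (IP X)))
  (g \oc pI X).
have [|f fE] := conf_factor_ker (f := h1 \oc iI X) (cI Y).
  by rewrite lcompA -h1E -lcompA (conf_comp0 (cI X)) lcompm0.
exists (cls Inj f); apply: (cls_cosyz_map (f' := f)); first by rewrite clsK.
by exists h1.
Qed.

Lemma ext_vanish_cosyz i N Y : (0 < i)%N ->
  ext_vanish PP i N (Cs Y) <-> ext_vanish PP i.+1 N Y.
Proof.
case: i => // i _; rewrite !ext_vanishE; split.
  by move/(extendable_syz_ker (cI Y)); apply; exact/extendable_inj/ihull_inj.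
move=> v; apply: (extendable_coker (cI Y)) v.
exact/extendable_inj/ihull_inj.
Qed.

Lemma lperp_le m m' (C : B -> Prop) X : (m' <= m)%N -> lperp PP m C X ->
  lperp PP m' C X.
Proof.
by move=> le H i Y /andP[i0 im]; apply: H; rewrite i0 (leq_trans im).
Qed.

Lemma rperp_le m m' (C : B -> Prop) X : (m' <= m)%N -> rperp PP m C X ->
  rperp PP m' C X.
Proof.
by move=> le H i Y /andP[i0 im]; apply: H; rewrite i0 (leq_trans im).
Qed.

Lemma rperp_cosyz m (C : B -> Prop) Y : rperp PP m.+1 C Y ->
  rperp PP m C (Cs Y).
Proof.
move=> H i N /andP[i0 im] CN; apply/ext_vanish_cosyz => //.
by apply: H => //; rewrite ltnS.
Qed.

(** Ext^{m+1}(X, P) is Ext^1(Omega^m X, P), so each degree of vanishing pays for one more syzygy. *)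
Lemma Omega_iter_ff m X Y : lperp PP m Proj X ->
  ff_at (lfiter m (Omega PP)) (X : stab B) (Y : stab B).
Proof.
elim: m => [|m IH] H; first by split=> // h; exists h.
apply: ff_comp; first by apply/IH/lperp_le/H.
apply: Omega_ff => P PP_; apply/ext_vanishE/H => //.
by rewrite ltnSn.
Qed.

Lemma rperp_cosyz_iter m j (C : B -> Prop) Y : rperp PP (m + j) C Y ->
  rperp PP j C (lfiter m (Omegabar IP) Y : B).
Proof.
elim: m j => [//|m IH] j H; apply: rperp_cosyz; apply: IH.
by rewrite addnS.
Qed.

Lemma Omegabar_iter_ff m X Y : rperp PP m Inj Y ->
  ff_at (lfiter m (Omegabar IP)) (X : costab B) (Y : costab B).
Proof.
elim: m => [|m IH] H; first by split=> // h; exists h.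
apply: ff_comp; first by apply/IH/rperp_le/H.
apply: Omegabar_ff => J JI.
have := @rperp_cosyz_iter m 1 Inj Y; rewrite addn1 => /(_ H) H1.
by apply/(ext_vanishE PP 0)/H1.
Qed.

Variables (n : nat) (T : AR_translation PP).

Lemma htau_ff X Y : lperp PP (n - 2) Proj X ->
  ff_at (htau n T) (X : stab B) (Y : stab B).
Proof.
move=> H; apply: ff_comp; first exact: Omega_iter_ff.
have [f1 f2] := equivalence_full_faithful (taumK T) (tauK T).
split=> [f e|]; last exact: f2.
by apply: f1; rewrite /= e lmap0.
Qed.

Lemma htaum_ff X Y : rperp PP (n - 2) Inj Y ->
  ff_at (htaum IP n T) (X : costab B) (Y : costab B).
Proof.
move=> H; apply: ff_comp; first exact: Omegabar_iter_ff.
have [f1 f2] := equivalence_full_faithful (tauK T) (taumK T).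
split=> [f e|]; last exact: f2.
by apply: f1; rewrite /= e lmap0.
Qed.

End FullFaithful.

(** * Cluster tilting subcategories *)

Section ClusterTiltingTheory.
Variables (k : fieldType) (B : exactcat k).
Variables (PP : enough_projectives B) (IP : enough_injectives B).
Variables (n : nat) (M : B -> Prop).
Hypotheses (hn : (2 <= n)%N) (hM : cluster_tilting PP n M).
Local Notation Proj := (@projective k B).
Local Notation Inj := (@injective k B).
Local Notation Cs X := (cosyz (IP X)).
Local Notation Ih X := (ihull (IP X)).
Local Notation iI X := (ihull_in (IP X)).
Local Notation pI X := (cosyz_out (IP X)).
Local Notation cI X := (inj_pres_conf (IP X)).
Implicit Types X Y Z N J K E W C : B.

Lemma M_lperp X : M X <-> lperp PP n.-1 M X.
Proof. by case: hM. Qed.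

Lemma M_rperp X : M X <-> rperp PP n.-1 M X.
Proof. by case: hM. Qed.

Lemma M_ext i X Y : (1 <= i <= n.-1)%N -> M X -> M Y -> ext_vanish PP i X Y.
Proof. by move=> hi /M_lperp MX MY; apply: MX. Qed.

Lemma M_ext1 X Y : M X -> M Y -> extendable PP X Y.
Proof.
by move=> MX MY; apply/(ext_vanishE PP 0)/M_ext => //; case: (n) hn => [|[]].
Qed.

Lemma M_proj P : projective P -> M P.
Proof.
by move=> PP_; apply/M_lperp => i Y /andP[i0 _] _; exact: ext_vanish_proj.
Qed.

Lemma M_inj J : injective J -> M J.
Proof.
by move=> JI; apply/M_rperp => i Y /andP[i0 _] _; exact: ext_vanish_inj.
Qed.

Lemma M_biprod X Y S (i1 : lhom X S) (i2 : lhom Y S) p1 p2 :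
  is_biproduct i1 i2 p1 p2 -> M X -> M Y -> M S.
Proof.
move=> b MX MY; apply/M_rperp => -[//|i] N hi MN; apply/ext_vanishE.
by apply: (extendable_biprod b); apply/ext_vanishE/M_ext.
Qed.

Let lt_n1 i : (1 <= i <= n - 2)%N -> (1 <= i <= n.-1)%N.
Proof. by case: (n) hn => [|[|m]] // _; rewrite subn2 => /andP[-> /leqW]. Qed.

Lemma M_sub_lperp X : M X -> lperp PP (n - 2) M X.
Proof. by move=> MX i Y /lt_n1 hi MY; apply: M_ext. Qed.

Lemma M_sub_rperp X : M X -> rperp PP (n - 2) M X.
Proof. by move=> MX i Y /lt_n1 hi MY; apply: M_ext. Qed.

Lemma lperp_M_Proj X : lperp PP (n - 2) M X -> lperp PP (n - 2) Proj X.
Proof. by move=> H i Y hi /M_proj; exact: H. Qed.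

Lemma rperp_M_Inj X : rperp PP (n - 2) M X -> rperp PP (n - 2) Inj X.
Proof. by move=> H i Y hi /M_inj; exact: H. Qed.

(** For N in M, Ext^1(N, K) vanishes because maps from N lift along [p]; for 2 <= i <= n - 1,
    Ext^i(N, K) lies between Ext^{i-1}(N, W) and Ext^i(N, E). *)
Lemma M_right_kernel K E W (i : lhom K E) (p : lhom E W) :
  conflation i p -> M E -> rperp PP (n - 2) M W ->
  (forall N (f : lhom N W), M N -> exists g, f = p \oc g) -> M K.
Proof.
move=> c ME MW H; apply/M_rperp => -[//|j] N; case/andP=> _ hj MN.
apply/ext_vanishE; case: j hj => [|j] hj.
  by apply: (extendable_ker c); [move=> f; exact: H|exact: M_ext1].
apply: (extendable_syz_ker c).
  by apply/ext_vanishE/MW => //; move: hj; case: (n) => [|[|m]] //; rewrite subn2.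
by apply/(ext_vanishE PP j.+1)/M_ext.
Qed.

(** An approximation need not be a deflation; adding [pcov (PP W)], which lies in M, makes it one
    and keeps the lifting property. The result presents G(W). *)
Lemma right_approx W : rperp PP (n - 2) M W ->
  exists K E (i : lhom K E) (p : lhom E W),
    [/\ conflation i p, M K, M E
      & forall N (f : lhom N W), M N -> exists g, f = p \oc g].
Proof.
move=> MW; have [cov _ _ _] := hM; have [Z [p0 [MZ p0E]]] := cov W.
have [E [i1 [i2 [p1 [p2 [b [K [i c]]]]]]]] := biprod_deflation p0 (defl_pO PP W).
have H N (f : lhom N W) : M N ->
    exists g, f = (pcov_out (PP W) \oc p1 + p0 \oc p2) \oc g.
  move=> MN; have [g ->] := p0E _ f MN; exists (i2 \oc g).
  case: b => _ e2 e12 _ _.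
  rewrite lcompDl -!lcompA (lcompA p1) (lcompA p2) e2 e12.
  by rewrite lcomp0m lcompm0 lcomp1m add0r.
have ME : M E by apply: (M_biprod b) => //; exact/M_proj/pcov_proj.
exists K, E, i, (pcov_out (PP W) \oc p1 + p0 \oc p2); split=> //.
exact: M_right_kernel c ME MW H.
Qed.

(** Balancing of Ext^1: its vanishing is read off the injective presentation of Y, which opens the
    way to contravariant sequences. *)
Lemma extendable_cosyz N Y :
  (forall f : lhom N (Cs Y), exists g, f = pI Y \oc g) <-> extendable PP N Y.
Proof.
split=> [H|]; last exact: (extendable_lift (cI Y)).
apply: (extendable_ker (cI Y)) => //.
exact/extendable_inj/ihull_inj.
Qed.

(** Exactness at Ext^1(C, Y) of the long sequence of Hom(-, Y). *)
Lemma extendable_left_coker X E C Y (j : lhom X E) (q : lhom E C) :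
  conflation j q -> (forall f : lhom X Y, exists g, f = g \oc j) ->
  extendable PP E Y -> extendable PP C Y.
Proof.
move=> c H EY; apply/extendable_cosyz => f.
have [g gE] := (extendable_cosyz _ _).2 EY (f \oc q).
have [|a aE] := conf_factor_ker (f := g \oc j) (cI Y).
  by rewrite lcompA -gE -lcompA (conf_comp0 c) lcompm0.
have [b bE] := H a.
have [|g' g'E] := conf_factor_coker (f := g - iI Y \oc b) c.
  by rewrite lcompBl aE bE lcompA subrr.
exists g'; apply: (conf_epi c).
by rewrite -lcompA -g'E lcompBr lcompA (conf_comp0 (cI Y)) lcomp0m subr0.
Qed.

Lemma ext_vanish_shift i j X Y :
  ext_vanish PP (i + j).+1 X Y <->
  ext_vanish PP j.+1 X (lfiter i (Omegabar IP) Y : B).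
Proof.
elim: i j => [//|i IHi] j; rewrite addSnnS; apply: iff_trans (IHi _) _.
by apply: iff_sym; exact: ext_vanish_cosyz.
Qed.

(** Dual to [right_approx], with the injective hull of X added; the result presents F(X). *)
Lemma left_approx X : lperp PP (n - 2) M X ->
  exists E C (j : lhom X E) (q : lhom E C), [/\ conflation j q, M E & M C].
Proof.
move=> MX; have [_ con _ _] := hM; have [Z [j0 [MZ j0E]]] := con X.
have [E [i1 [i2 [p1 [p2 [b [C [q c]]]]]]]] := biprod_inflation j0 (infl_iI IP X).
set j := _ + _ in c.
have H N (f : lhom X N) : M N -> exists g, f = g \oc j.
  move=> MN; have [g ->] := j0E _ f MN; exists (g \oc p2).
  case: b => _ e2 _ e12 _.
  rewrite lcompDr -!lcompA (lcompA p2 i1) (lcompA p2 i2) e2 e12.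
  by rewrite lcomp0m lcompm0 lcomp1m add0r.
have ME : M E by apply: (M_biprod b) => //; exact/M_inj/ihull_inj.
exists E, C, j, q; split=> //; apply/M_lperp => -[//|i] N; case/andP=> _ hi MN.
(* Ext^{i+1}(C, N) is Ext^1(C, -) at the i-th cosyzygy of N. Maps from X to that cosyzygy must
   extend along [j]: for i = 0 by approximation, for i > 0 because Ext^i(X, N) = 0 lifts them to an
   injective object. *)
rewrite -[i]addn0; apply/ext_vanish_shift/ext_vanishE.
apply: (extendable_left_coker c); last first.
  by apply/(ext_vanishE PP 0)/ext_vanish_shift/M_ext; rewrite ?addn0.
case: i hi => [|i] hi f; first exact: H.
have [|g ->] := (extendable_cosyz _ _).2 _ f.
  apply/(ext_vanishE PP 0)/ext_vanish_shift/MX => //; rewrite addn0.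
  by move: hi; case: (n) => [|[|m]] //; rewrite subn2.
have [|g' ->] := iI_extend g (@ihull_inj _ _ _ (IP _)) (i := j).
  by exists C, q.
by exists (pI _ \oc g'); rewrite lcompA.
Qed.

Lemma inj_cosyz_class J : injective J -> cosyz_class M J.
Proof.
move=> JI; have [Z [i [Z0 c]]] := zero_conflation J.
exists Z, J, i, (lid J); split=> //; apply: M_proj => V W p f _.
by exists 0; rewrite lcompm0 (hom_from0 f Z0).
Qed.

(** Ext^1(M, M) = 0 lifts the map to an injective; this is why G kills the ideal of Omegabar M. *)
Lemma cosyz_class_hom0 Z C (f : lhom Z C) : M Z -> cosyz_class M C ->
  f \in ideal Inj Z C.
Proof.
move=> MZ [N [J [i [p [MN JI c]]]]].
have [g ->] := extendable_lift c (M_ext1 MZ MN) f.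
exact: ideal_through.
Qed.

(* An injective M-approximation of W exists, and it becomes a deflation after
   adding a projective object P; enlarging P to an injective object turns the
   resulting conflation into one witnessing [cosyz_class], at the price of
   making W a direct summand only. *)
Lemma cosyz_class_summand W : rperp PP (n - 2) M W ->
  (forall N (f : lhom N W), M N -> f \in ideal Inj N W) ->
  exists K E W' (i : lhom K E) (p : lhom E W') (s : lhom W W') (r : lhom W' W),
    [/\ M K, injective E, conflation i p & r \oc s = lid W].
Proof.
move=> MW W0; have [cov _ _ _] := hM; have [Z [p0 [MZ p0E]]] := cov W.
have [J [b [a [JI p0J]]]] := (injective_factors _).1 (W0 _ p0 MZ).
have bE N (f : lhom N W) : M N -> exists g, f = b \oc g.
  move=> MN; have [g ->] := p0E _ f MN; exists (a \oc g).
  by rewrite p0J lcompA.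
pose P := pcov (PP W); have PP_ : projective P by exact: pcov_proj.
have [g gE] := bE _ (pcov_out (PP W)) (M_proj PP_).
have [T [t1 [t2 [q1 [q2 [bT dT]]]]]] := biprod_deflation b (defl_pO PP W).
(* [pcov_out (PP W)] factors as [b \oc g], so a shear of [T] removes it from the deflation. *)
have dE : deflation (b \oc q2).
  have -> : b \oc q2 = (pcov_out (PP W) \oc q1 + b \oc q2) \oc
      (lid T + t2 \oc (- 1 *: g) \oc q1).
    have [e1 e2 e3 e4 e5] := bT.
    rewrite lcompDr lcompm1 lcompDl -!lcompA (lcompA q1 t2) (lcompA q2 t2).
    rewrite e3 e2 lcomp0m lcompm0 lcomp1m add0r lcompZl lcompZr.
    by rewrite lcompA -gE scaleN1r addrAC subrr add0r.
  apply: defl_comp dT; exact/liso_deflation/(shear_liso _ bT).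
have [K [i c]] := dE.
have MT : M T by apply: (M_biprod bT); [exact: M_proj|exact: M_inj].
have MK : M K.
  apply: (M_right_kernel c) => // N f /bE bN; have [h ->] := bN f.
  exists (t2 \oc h); have [_ e2 _ _ _] := bT.
  by rewrite -lcompA (lcompA q2) e2 lcomp1m.
(* This pushout replaces T = P + J by the injective object [ihull (IP P)] + J. *)
have [E [j [i1 [p1 [p2 [bS ij ji pj]]]]]] := pushout_biprod (infl_iI IP P) bT.
have EI : injective E by apply: (injective_biprod bS) => //; exact: ihull_inj.
have [|W' [e ce]] := infl_comp (i := i) (j := j) _ ij.
  by exists W, (b \oc q2).
have [|r rE] := conf_factor_coker (f := b \oc p2) ce.
  by rewrite lcompA -(lcompA b) pj (conf_comp0 c).
have [|s sE] := conf_factor_coker (f := e \oc j) c.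
  by rewrite -lcompA (conf_comp0 ce).
exists K, E, W', (j \oc i), e, s, r; split=> //.
apply: (conf_epi c).
by rewrite -lcompA -sE lcompA -rE -lcompA pj lcomp1m.
Qed.

(** The two injective copresentations of K map to each other over the identity of K; the composite
    on [E] differs from the identity by a map killing [i], hence factoring through [p]. *)
Lemma cosyz_class_Omegabar K E W (i : lhom K E) (p : lhom E W) :
  conflation i p -> injective E ->
  exists (s : lhom W (Cs K)) (r : lhom (Cs K) W),
    cls Inj (r \oc s) = cls Inj (lid W).
Proof.
move=> c EI; have ii : inflation i by exists W, p.
have [h hE] := iI_extend (iI K) (@ihull_inj _ _ _ (IP K)) ii.
have [h' hE'] := iI_extend i EI (infl_iI IP K).
have [|s sE] := conf_factor_coker (f := pI K \oc h) c.
  by rewrite -lcompA -hE (conf_comp0 (cI K)).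
have [|r rE] := conf_factor_coker (f := p \oc h') (cI K).
  by rewrite -lcompA -hE' (conf_comp0 c).
exists s, r; apply/clsP.
have [|t tE] := conf_factor_coker (f := h' \oc h - lid E) c.
  by rewrite lcompBl lcomp1m -lcompA -hE -hE' subrr.
have -> : r \oc s - lid W = p \oc t.
  apply: (conf_epi c); rewrite lcompBl lcomp1m -lcompA -sE lcompA -rE.
  by rewrite -(lcompA p t) -tE lcompBr lcompm1 lcompA.
exact: ideal_through.
Qed.

End ClusterTiltingTheory.

(** * The arrows of the square *)

Section ModuleLemmas.
Variables (k : fieldType) (D : lincat k).

Lemma hom_module_act (X Y Z : D) (f : lhom X Y) (g : lhom Y Z) :
  mact (hom_module Z) f g = g \oc f.
Proof. by rewrite linfun_linE //; exact: lcompPl. Qed.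

Lemma hom_module_mapE (X Y Z : D) (g : lhom Y Z) (f : lhom X Y) :
  hom_module_map g X f = g \oc f.
Proof. by rewrite linfun_linE //; exact: lcompPr. Qed.

Lemma module_hom_yoneda (A : module D) (Z X : D)
    (p : module_hom (hom_module Z) A) (f : lhom X Z) :
  p X f = mact A f (p Z (lid Z)).
Proof. by rewrite -mhom_nat hom_module_act lcomp1m. Qed.

End ModuleLemmas.

Lemma ext1_pull_linl (k : fieldType) (B : exactcat k)
    (PP : enough_projectives B) (X X' Y : B) (e : Ext1 PP X Y) :
  linear (fun f : lhom (X' : stab B) X => ext1_pull PP Y f e).
Proof.
move=> a f g; have [f0 ->] := quot_lift f; have [g0 ->] := quot_lift g.
have [f1 fL] := syz_lift_exists PP f0; have [g1 gL] := syz_lift_exists PP g0.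
rewrite -(qrepK e) -[_ *: _ + _]cls_linear.
rewrite (ext1_pullE _ fL) (ext1_pullE _ gL) (ext1_pullE _ (syz_lift_lin a fL gL)).
by rewrite lcompDr lcompZr qcls_linear.
Qed.

Section DualIso.
Variables (k : fieldType) (B : exactcat k) (DX DY : B -> Prop).
Variables (V W : B -> B -> vectType k).
Variables (Vmap : forall X X' Y Y', lhom X' X -> lhom Y Y' -> V X Y -> V X' Y').
Variables (Wmap : forall X X' Y Y', lhom X' X -> lhom Y Y' -> W X' Y' -> W X Y).
Hypothesis d : dual_iso DX DY Vmap Wmap.

Lemma dual_iso_l0 X Y : DX X -> DY Y -> (forall w : W X Y, w = 0) ->
  forall v : V X Y, v = 0.
Proof.
have [t [bt _]] := d => hX hY w0 v.
apply: (bij_inj (bt _ _ hX hY)); apply/lfunP => w.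
by rewrite (w0 w) !linear0.
Qed.

Lemma dual_iso_r0 X Y : DX X -> DY Y -> (forall v : V X Y, v = 0) ->
  forall w : W X Y, w = 0.
Proof.
have [t [bt _]] := d => hX hY v0 w; apply: dual_sep => f.
have [s _ ts] := bt _ _ hX hY.
by rewrite -(ts f) (v0 (s f)) linear0 lfunE.
Qed.

End DualIso.

(** * Well-definedness of the left arrow, F, G and the base functor of mu *)

Section WellDefined.
Variables (k : fieldType) (B : exactcat k).
Variables (PP : enough_projectives B) (IP : enough_injectives B).
Variables (n : nat) (M : B -> Prop).
Hypotheses (hn : (2 <= n)%N) (hM : cluster_tilting PP n M).
Variable T : AR_translation PP.
Hypothesis hT : higher_AR IP n T.
Local Notation Proj := (@projective k B).
Local Notation Inj := (@injective k B).
Local Notation Cs X := (cosyz (IP X)).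
Implicit Types X Y Z N : B.

(** Ext^i(Y, tau_{n-1} X) is dual to Ext^{n-1-i}(X, Y), and i |-> n - 1 - i preserves the range 1,
    ..., n - 2. *)
Lemma htau_rperp X : lperp PP (n - 2) M X -> rperp PP (n - 2) M (htau n T X).
Proof.
move=> hX i Y hi MY; apply: (dual_iso_r0 (hAR_ext hT hi)).
- exact: lperp_M_Proj hX.
- exact/(rperp_M_Inj hM)/(M_sub_rperp hn hM).
by apply: hX => //; lia.
Qed.

(** This Hom space is dual to Ext^{n-1}(X, Z). Its vanishing makes tau_{n-1} X a summand of a
    cosyzygy of M in [htau_summand]. *)
Lemma htau_hom0 X Z (f : lhom (Z : costab B) (htau n T X)) :
  M X -> M Z -> f = 0.
Proof.
move=> MX MZ; apply: (dual_iso_r0 (hAR_duality hT)) f.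
- exact/(lperp_M_Proj hM)/(M_sub_lperp hn hM).
- exact/(rperp_M_Inj hM)/(M_sub_rperp hn hM).
by apply: (M_ext hM) => //; lia.
Qed.

Lemma htau_summand X : M X ->
  exists K E W (i : lhom K E) (p : lhom E W) (s : lhom (htau n T X : B) W) r,
    [/\ M K, injective E, conflation i p & r \oc s = lid (htau n T X : B)].
Proof.
move=> MX; apply: (cosyz_class_summand IP hn hM).
  exact/htau_rperp/(M_sub_lperp hn hM).
by move=> N f MN; apply/cls_eq0/htau_hom0.
Qed.

Lemma left_well_defined : left_wd M n T.
Proof.
split=> [X|X Y f _ _ fI|X Y f]; first exact: htau_rperp.
  have cI (U V : B) (g : lhom U V) : g \in ideal Inj U V ->
      g \in ideal (cosyz_class M) U V.
    by apply: ideal_sub => J; exact: inj_cosyz_class hM _.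
  pose Q (g : lhom X Y) := qrep (lmap (htau n T) (cls Proj g)) \in
    ideal (cosyz_class M) (htau n T X : B) (htau n T Y : B).
  apply: (spanv_ind (Q := Q)) fI; rewrite /Q.
  - by rewrite cls0 lmap0 linear0 mem0v.
  - by move=> a u v uI vI; rewrite cls_linear lmap_lin linearP rpredD ?rpredZ.
  move=> _ [Z [b [a [MZ ->]]]].
  have -> : cls Proj (b \oc a) =
      (cls Proj b : lhom (Z : stab B) (Y : stab B)) \oc
      (cls Proj a : lhom (X : stab B) (Z : stab B)) by rewrite /= cls_comp.
  rewrite lmapM.
  have [b' ->] := quot_lift (lmap (htau n T)
    (cls Proj b : lhom (Z : stab B) (Y : stab B))).
  have [a' ->] := quot_lift (lmap (htau n T)
    (cls Proj a : lhom (X : stab B) (Z : stab B))).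
  rewrite [lcomp _ _]cls_comp -(subrK (b' \oc a') (qrep _)); apply: rpredD.
    by apply: cI; exact: qrep_cls.
  (* The composite passes through tau_{n-1} Z, and so through the object of Omegabar M of which it
     is a summand. *)
  have [K [E [W [i [p [s [r [MK EI c rs]]]]]]]] := htau_summand MZ.
  rewrite -[b']lcompm1 -rs lcompA -lcompA; apply: ideal_through.
  by exists K, E, i, p.
by apply: ideal_sub => J; exact: inj_cosyz_class hM _.
Qed.

(** For X -> E -> C with E and C in M, the sequence Hom(-, E) -> Hom(-, C) -> Ext^1(-, X) ->
    Ext^1(-, E) = 0 on M gives the presentation, also modulo projectives. *)
Lemma F_well_defined : F_wd PP M n.
Proof.
split=> [X hX|X Y f g _ _ fgI].
  have [E [C [j [q [c ME MC]]]]] := left_approx IP hM hX.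
  have [w wc] := conn_exists PP c.
  pose e := qcls (ext_bound PP C X) w.
  pose D1 : stabM M := exist M E ME; pose D0 : stabM M := exist M C MC.
  pose q' : lhom D1 D0 := cls Proj q.
  pose pf (Z : stabM M) : 'Hom(lhom Z D0, extM PP M X Z) :=
    linfun (fun h : lhom Z D0 => ext1_pull PP X h e).
  have pE (Z : stabM M) (h : lhom Z D0) : pf Z h = ext1_pull PP X h e.
    rewrite /pf linfun_linE //; exact: ext1_pull_linl.
  have pn (Z Z' : stabM M) (g : lhom Z Z') (h : hom_module D0 Z') :
      pf Z (mact (hom_module D0) g h) = mact (extM PP M X) g (pf Z' h).
    by rewrite hom_module_act !pE; exact: ext1_pullM.
  exists D1, D0, (hom_module_map q'), (ModuleHom pn) => Z; split=> [a|h].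
    have [|h hE] := conn_onto (Z := sval Z) (e := a) c wc.
      by rewrite -(qrepK a) ext1_pushE; apply/qcls_ext0/(M_ext1 hn hM)/ME/(svalP Z).
    by exists (cls Proj h); exact: etrans (pE _ _) hE.
  apply: iff_trans (_ : ext1_pull PP X h e = 0 <-> _); first by rewrite -pE.
  split=> [|[h1 <-]].
    have [h0 ->] := quot_lift (h : lhom (sval Z : stab B) C).
    move=> /(conn_pull0 _ c wc)[h1 ->]; exists (cls Proj h1).
    by rewrite hom_module_mapE; exact: cls_comp.
  have [h0 ->] := quot_lift (h1 : lhom (sval Z : stab B) E).
  rewrite hom_module_mapE /q' [lcomp _ _]cls_comp.
  by apply/(conn_pull0 _ c wc); exists h0.
apply: module_homP => Z e.
have [u ->] : exists u, e = qcls (ext_bound PP (sval Z) X) u.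
  by exists (qrep e); rewrite qrepK.
rewrite [LHS]ext1_pushE [RHS]ext1_pushE; apply/qclsP/ext_boundP.
rewrite -lcompBl.
(* The condition is linear in [f - g], so a map through some N in M may be taken; its action passes
   through Ext^1(Z, N) = 0. *)
suff [h hE] : exists h, (f - g) \oc u = h \oc syz_in (PP (sval Z)) by exists h.
move: fgI; apply: (spanv_ind (Q := fun r => exists h, r \oc u = h \oc syz_in _)).
- by exists 0; rewrite !lcomp0m.
- move=> a r r' [h hE] [h' hE']; exists (a *: h + h').
  by rewrite !lcompDl !lcompZl hE hE'.
move=> _ [N [b [a [MN ->]]]].
have [h hE] := M_ext1 hn hM (svalP Z) MN (a \oc u).
by exists (b \oc h); rewrite -!lcompA hE.
Qed.

Lemma G_well_defined : G_wd PP M n.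
Proof.
split=> [W hW|X Y f g _ _ fgI].
  have [K [E [i [p [c MK ME pE]]]]] := right_approx hn hM hW.
  pose D1 : costabM M := exist M K MK; pose D0 : costabM M := exist M E ME.
  pose i' : lhom D1 D0 := cls Inj i.
  pose p' : lhom (E : costab B) W := cls Inj p.
  pose pf (Z : costabM M) : 'Hom(lhom Z D0, cohomM M W Z) :=
    hom_module_map p' (sval Z).
  have pfE (Z : costabM M) (h : lhom Z D0) : pf Z h = p' \oc h.
    exact: hom_module_mapE.
  have pn (Z Z' : costabM M) (g : lhom Z Z') (h : hom_module D0 Z') :
      pf Z (mact (hom_module D0) g h) = mact (cohomM M W) g (pf Z' h).
    rewrite hom_module_act !pfE [RHS]hom_module_act; exact: lcompA.
  exists D1, D0, (hom_module_map i'), (ModuleHom pn) => Z; split=> [a|h].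
    have [a0 ->] := quot_lift (a : lhom (sval Z : costab B) W).
    have [h ->] := pE _ a0 (svalP Z).
    by exists (cls Inj h); rewrite [LHS]pfE [LHS]cls_comp.
  apply: iff_trans (_ : p' \oc h = 0 <-> _); first by rewrite -pfE.
  split=> [|[h1 <-]].
    have [h0 ->] := quot_lift (h : lhom (sval Z : costab B) E).
    rewrite /p' [lcomp _ _]cls_comp => /cls_eq0/injective_factors[J [b [a [JI e]]]].
    (* Injectives lie in M, so [b] lifts along [p]; subtracting [b' \oc a], zero in the costable
       category, moves [h0] into the kernel of [p]. *)
    have [b' bE] := pE _ b (M_inj hM JI).
    have [|h1 hE] := conf_factor_ker (f := h0 - b' \oc a) c.
      by rewrite lcompBr e bE lcompA subrr.
    exists (cls Inj h1); rewrite hom_module_mapE [LHS]cls_comp -hE.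
    by apply/clsP; rewrite addrAC subrr add0r rpredN; apply: ideal_through.
  have [h0 ->] := quot_lift (h1 : lhom (sval Z : costab B) K).
  rewrite hom_module_mapE /p' /i' [X in _ \oc X]cls_comp [lcomp _ _]cls_comp.
  by rewrite lcompA (conf_comp0 c) lcomp0m cls0.
apply: module_homP => Z h.
rewrite [LHS]hom_module_mapE [RHS]hom_module_mapE.
have [h0 ->] := quot_lift (h : lhom (sval Z : costab B) X).
rewrite [LHS]cls_comp [RHS]cls_comp; apply/clsP; rewrite -lcompBl.
move: fgI; apply: (spanv_ind (Q := fun r => r \oc h0 \in ideal Inj _ _)).
- by rewrite lcomp0m mem0v.
- by move=> a u v uI vI; rewrite lcompDl lcompZl rpredD ?rpredZ.
move=> _ [C [b [a [CC ->]]]]; rewrite -lcompA; apply: ideal_compl.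
exact: (cosyz_class_hom0 hn hM _ (svalP Z) CC).
Qed.

Lemma rperp_Cs X : M X -> rperp PP (n - 2) Inj (Cs X).
Proof.
move=> MX; apply: rperp_cosyz => i J hi JI.
by apply: (M_ext hM _ (M_inj hM JI) MX); lia.
Qed.

(** For i <= n - 2 the group is dual to Ext^{n-1-i}(Y, Omegabar X) = Ext^{n-i}(Y, X) = 0. For i = n
    - 1 it is dual to Hom(tau^- Y, tau^- Omegabar X) with tau^- = tau_{n-1}^-, and by full
    faithfulness this is the costable Hom(Y, Omegabar X) = 0. *)
Lemma htaum_Cs_M X : M X -> M (htaum IP n T (Cs X)).
Proof.
move=> MX; apply/(M_lperp hM) => i Y hi MY.
have hY : lperp PP (n - 2) Proj Y by exact/(lperp_M_Proj hM)/(M_sub_lperp hn hM).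
have hX := rperp_Cs MX.
have [hi'|hi'] := leqP i (n - 2).
  have hi2 : (1 <= i <= n - 2)%N by lia.
  apply: (dual_iso_r0 (hAR_extm hT hi2)) => //.
  apply/ext_vanish_cosyz; first lia.
  by apply: (M_ext hM) => //; lia.
have -> : i = (n - 1)%N by lia.
apply: (dual_iso_l0 (hAR_dualitym hT)).
- exact: htaum_ob hT _ hX.
- exact/(rperp_M_Inj hM)/(M_sub_rperp hn hM).
move=> w; have [h <-] := (htaum_ff IP T _ hX).2 w.
have [h0 ->] := quot_lift h.
suff -> : cls Inj h0 = 0 by rewrite lmap0.
apply/cls_eq0; apply: (cosyz_class_hom0 hn hM _ MY).
exists X, (ihull (IP X)), (ihull_in (IP X)), (cosyz_out (IP X)).
by split=> //; [exact: ihull_inj|exact: inj_pres_conf].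
Qed.

Lemma mu_base_well_defined : mu_base_wd IP M n T.
Proof.
split=> [X|X Y f _ _ fI|//]; first exact: htaum_Cs_M.
by rewrite (_ : cls Inj f = 0) ?lmap0 ?linear0 ?mem0v //; apply/cls_eq0.
Qed.

End WellDefined.

(** Chooses the isomorphisms of [pairing_iso] uniformly; the separation clause allows their
    naturality to be tested on [U]. *)
Lemma pairing_family (k : fieldType) (I J : Type) (P : I -> J -> Prop)
    (U W W' : I -> J -> vectType k)
    (A : forall i j, U i j -> W i j -> k^o)
    (A' : forall i j, U i j -> W' i j -> k^o) :
  (forall i j, P i j ->
    [/\ bilin (@A i j), bilin (@A' i j), onto_dual (@A i j), onto_dual (@A' i j)
      & forall u, (forall w, A' i j u w = 0) <-> (forall w, A i j u w = 0)]) ->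
  exists a : forall i j, 'Hom(W i j, W' i j), forall i j, P i j ->
    [/\ bijective (a i j), forall u w, A i j u w = A' i j u (a i j w)
      & forall w w', (forall u, A' i j u w = A' i j u w') -> w = w'].
Proof.
move=> H.
have e i j : exists a : 'Hom(W i j, W' i j), P i j ->
    [/\ bijective a, forall u w, A i j u w = A' i j u (a w)
      & forall w w', (forall u, A' i j u w = A' i j u w') -> w = w'].
  (* Outside [P] the map is set to zero. *)
  have [Pij|nP] := pselect (P i j); last by exists 0.
  have [b b' o o' AA] := H _ _ Pij; have [a [ab aE]] := pairing_iso b b' o o' AA.
  by exists a => _; split=> // w w'; exact: onto_dual_sep.
exists (fun i j => projT1 (cid (e i j))) => i j Pij.
by case: cid => a; apply.
Qed.

Lemma bilin_dual (k : fieldType) (V W : vectType k) (t : 'Hom(V, 'Hom(W, k^o))) :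
  bilin (fun v w => t v w).
Proof.
split=> [w x u v|u x v w]; last exact: linearP.
by rewrite linearP add_lfunE scale_lfunE.
Qed.

Lemma onto_dual_bij (k : fieldType) (V W : vectType k) (t : 'Hom(V, 'Hom(W, k^o))) :
  bijective t -> onto_dual (fun v w => t v w).
Proof. by move=> [s st ts] f; exists (s f) => w; rewrite ts. Qed.

Lemma dual_bij_eq0 (k : fieldType) (V W : vectType k) (t : 'Hom(V, 'Hom(W, k^o))) v :
  bijective t -> (forall w, t v w = 0) <-> v = 0.
Proof.
move=> bt; split=> [tv|-> w]; last by rewrite linear0 lfunE.
by apply: (bij_inj bt); rewrite linear0; apply/lfunP => w; rewrite tv lfunE.
Qed.

Section DualIsoPair.
Variables (k : fieldType) (B : exactcat k) (DX DY : B -> Prop).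
Variables (V W W' : B -> B -> vectType k).
Variables (Vmap : forall X X' Y Y', lhom X' X -> lhom Y Y' -> V X Y -> V X' Y').
Variables (Wmap : forall X X' Y Y', lhom X' X -> lhom Y Y' -> W X' Y' -> W X Y).
Variables (Wmap' : forall X X' Y Y', lhom X' X -> lhom Y Y' -> W' X' Y' -> W' X Y).

(** Both targets are dual to [V], so naturality is checked by pairing with [V]. For the two Hom
    dualities this is an adjunction. *)
Lemma dual_iso_pair :
  dual_iso DX DY Vmap Wmap -> dual_iso DX DY Vmap Wmap' ->
  exists a : forall X Y, 'Hom(W X Y, W' X Y),
    (forall X Y, DX X -> DY Y -> bijective (a X Y)) /\
    (forall X X' Y Y' (f : lhom X' X) (g : lhom Y Y'),
       DX X -> DX X' -> DY Y -> DY Y' -> forall w,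
       a X Y (Wmap f g w) = Wmap' f g (a X' Y' w)).
Proof.
move=> [t [bt nt]] [t' [bt' nt']].
have [|a aP] := @pairing_family k B B (fun X Y => DX X /\ DY Y) V W W'
    (fun X Y v w => t X Y v w) (fun X Y v w => t' X Y v w).
  move=> X Y [hX hY]; split; try exact: bilin_dual.
  - exact/onto_dual_bij/bt.
  - exact/onto_dual_bij/bt'.
  move=> v; rewrite (dual_bij_eq0 _ (bt _ _ hX hY)).
  exact: (dual_bij_eq0 _ (bt' _ _ hX hY)).
exists a; split=> [X Y hX hY|X X' Y Y' f g hX hX' hY hY' w].
  by have [] := aP _ _ (conj hX hY).
have [_ aE sep] := aP _ _ (conj hX hY); have [_ aE' _] := aP _ _ (conj hX' hY').
by apply: sep => v; rewrite -aE -nt // -nt' // aE'.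
Qed.

End DualIsoPair.

(** * Finite presentations under precomposition *)

Section PrecompFinpres.
Variables (k : fieldType) (A D : lincat k) (E : lfunctor A D).
Hypothesis Eff : forall X Y, ff_at E X Y.
Hypothesis Edense : forall d : D,
  exists (a : A) (s : lhom d (E a)) (r : lhom (E a) d), r \oc s = lid d.
Hypothesis biprodA : forall X Y : A,
  exists S (i1 : lhom X S) (i2 : lhom Y S) (p1 : lhom S X) (p2 : lhom S Y),
    is_biproduct i1 i2 p1 p2.

(* If D1 -> D0 presents C and (s_i, r_i) exhibits D_i as a summand of E a_i,
   then C is also the cokernel of (s0 u r1, 1 - s0 r0) : E a1 + E a0 -> E a0. *)
Lemma full_dense_preserves_finpres : preserves_finpres E.
Proof.
move=> C [D1 [D0 [u [p pP]]]].
have [a1 [s1 [r1 e1]]] := Edense D1; have [a0 [s0 [r0 e0]]] := Edense D0.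
pose u0 : lhom D1 D0 := u D1 (lid D1).
have uE X (h : lhom X D1) : u X h = u0 \oc h.
  by rewrite module_hom_yoneda hom_module_act.
have [f fE] := (Eff a1 a0).2 (s0 \oc u0 \oc r1).
have [g gE] := (Eff a0 a0).2 (lid _ - s0 \oc r0).
have [S [i1 [i2 [q1 [q2 bS]]]]] := biprodA a1 a0.
pose v : lhom S a0 := f \oc q1 + g \oc q2.
pose P (Z : A) : 'Hom(lhom Z a0, C (E Z)) :=
  linfun (fun h : lhom Z a0 => p (E Z) (r0 \oc lmap E h)).
have PE (Z : A) (h : lhom Z a0) : P Z h = p (E Z) (r0 \oc lmap E h).
  rewrite /P linfun_linE // => c x y.
  by rewrite lmap_lin lcompDr lcompZr linearP.
have Pn (Z Z' : A) (h : lhom Z Z') (x : hom_module a0 Z') :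
    P Z (mact (hom_module a0) h x) = mact (precomp_module E C) h (P Z' x).
  by rewrite hom_module_act !PE lmapM lcompA -hom_module_act; exact: (mhom_nat p).
exists S, a0, (hom_module_map v).
exists (@ModuleHom _ _ (hom_module a0) (precomp_module E C) P Pn) => Z.
split=> [c|h].
  have [h hE] := (pP (E Z)).1 c; have [x xE] := (Eff Z a0).2 (s0 \oc h).
  by exists x; rewrite [LHS]PE xE lcompA e0 lcomp1m.
apply: iff_trans (_ : p (E Z) (r0 \oc lmap E h) = 0 <-> _); first by rewrite -PE.
split=> [/(pP (E Z)).2[x xE]|[h1 <-]].
  (* After applying [E], the component [x1] contributes [s0 \oc r0 \oc lmap E h], and the component
     [h] the complementary part. *)
  have [x1 x1E] := (Eff Z a1).2 (s1 \oc x).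
  exists (i1 \oc x1 + i2 \oc h); rewrite hom_module_mapE.
  apply: (ff_inj (Eff _ _)); rewrite lcompDr /v !lcompDl -!lcompA.
  have [e11 e22 e12 e21 _] := bS.
  rewrite (lcompA q1 i1) (lcompA q2 i1) (lcompA q1 i2) (lcompA q2 i2).
  rewrite e11 e22 e12 e21 !lcomp0m !lcomp1m !lcompm0 addr0 add0r.
  rewrite lmapD !lmapM fE gE x1E -!lcompA (lcompA r1) e1 lcomp1m.
  by rewrite lcompBl lcomp1m -lcompA -xE uE addrC subrK.
rewrite hom_module_mapE; apply/(pP (E Z)).2.
(* Composing with [r0] kills the part 1 - s0 r0 of the relation. *)
exists (r1 \oc lmap E (q1 \oc h1)).
rewrite uE /v lcompDl -!lcompA lmapD [in RHS]lmapM [lmap E (g \oc _)]lmapM fE gE.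
rewrite lcompDr lcompBl lcomp1m lcompBr !lcompA e0 !lcomp1m subrr addr0.
by [].
Qed.

End PrecompFinpres.

(** * The functor mu *)

Section MuWellDefined.
Variables (k : fieldType) (B : exactcat k).
Variables (PP : enough_projectives B) (IP : enough_injectives B).
Variables (n : nat) (M : B -> Prop).
Hypotheses (hn : (2 <= n)%N) (hM : cluster_tilting PP n M).
Variable T : AR_translation PP.
Hypothesis hT : higher_AR IP n T.
Local Notation Proj := (@projective k B).
Local Notation Inj := (@injective k B).
Local Notation Cs X := (cosyz (IP X)).
Implicit Types X Y Z N : B.

(* The duality formulas make htaum left adjoint to htau; as htau is fully
   faithful, the counit has a section. *)
Lemma htaum_htau_summand X : lperp PP (n - 2) Proj X ->
  exists (s : lhom (X : stab B) (htaum IP n T (htau n T X)))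
         (r : lhom (htaum IP n T (htau n T X)) (X : stab B)), r \oc s = lid _.
Proof.
move=> hX; have [a [ba na]] := dual_iso_pair (hAR_duality hT) (hAR_dualitym hT).
pose Y : B := htau n T X; have hY : rperp PP (n - 2) Inj Y := htau_ob hT hX.
pose X2 : B := htaum IP n T Y.
have hX2 : lperp PP (n - 2) Proj X2 := htaum_ob hT hY.
pose e : lhom (X2 : stab B) (X : stab B) := a X Y (lid (Y : costab B)).
have [b _ ab] := ba _ _ hX2 hY.
pose u : lhom (Y : costab B) (htau n T X2) := b (lid (X2 : stab B)).
have [f fE] := quot_lift e.
have := na _ _ _ _ f (lid Y) hX hX2 hY hY u.
rewrite /act_cohom /act_hom -fE /u ab -/u => nat_e.
have eu : lmap (htau n T) e \oc u = lid (Y : costab B).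
  apply: (bij_inj (ba _ _ hX hY)).
  rewrite -[lmap _ e \oc u]lcompm1; apply: etrans nat_e _.
  rewrite lcompm1 -[cls Inj (lid Y)]/(lid (Y : costab B)) lmap1.
  exact: lcompm1.
have [s sE] := (htau_ff T (X2 : B) hX).2 u.
exists s, e; apply: (ff_inj (htau_ff T X hX)).
by rewrite lmapM sE lmap1.
Qed.

(** Density up to summands: X is a summand of tau_{n-1}^- tau_{n-1} X, and tau_{n-1} X is, modulo
    injectives, a summand of [Cs K]. *)
Lemma M_summand_mu X : M X -> exists K (s : lhom (X : stab B) (htaum IP n T (Cs K)))
    (r : lhom (htaum IP n T (Cs K)) (X : stab B)), M K /\ r \oc s = lid _.
Proof.
move=> MX; have hX := lperp_M_Proj hM (M_sub_lperp hn hM MX).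
have [s1 [r1 e1]] := htaum_htau_summand hX.
have [K [E [W [i [p [s2 [r2 [MK EI c e2]]]]]]]] := htau_summand hn hM hT MX.
have [s3 [r3 e3]] := cosyz_class_Omegabar IP c EI.
pose s4 : lhom (htau n T X) (Cs K : costab B) := cls Inj (s3 \oc s2).
pose r4 : lhom (Cs K : costab B) (htau n T X) := cls Inj (r2 \oc r3).
have e4 : r4 \oc s4 = lid (htau n T X).
  rewrite [LHS]cls_comp lcompA -(lcompA r2) -cls_comp -(cls_comp _ r2) e3.
  by rewrite !cls_comp lcompm1 e2.
exists K, (lmap (htaum IP n T) s4 \oc s1), (r1 \oc lmap (htaum IP n T) r4).
split=> //; rewrite lcompA -(lcompA r1) -lmapM e4 lmap1.
by rewrite lcompm1.
Qed.

Variable w : mu_base_wd IP M n T.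

Lemma mu_baseE (X Y : costabM M) (f : lhom X Y) :
  lmap (mu_base w) f = lmap (lfcomp (htaum IP n T) (Omegabar IP))
    (f : lhom (sval X : costab B) (sval Y)).
Proof. by rewrite /= /induced_map !clsK. Qed.

Lemma mu_base_ff (X Y : costabM M) : ff_at (mu_base w) X Y.
Proof.
have MY := svalP Y.
have [f1 f2] : ff_at (lfcomp (htaum IP n T) (Omegabar IP))
    (sval X : costab B) (sval Y : costab B).
  apply: ff_comp.
    by apply: (Omegabar_ff (PP := PP)) => J /(M_inj hM) MJ; exact: (M_ext1 hn hM).
  by apply: htaum_ff; exact: (@rperp_Cs _ _ _ _ _ _ hn hM _ MY).
split=> [f|h]; first by rewrite mu_baseE; exact: f1.
by have [f fE] := f2 h; exists f; rewrite mu_baseE.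
Qed.

Lemma mu_well_defined : preserves_finpres (mu_base w).
Proof.
apply: full_dense_preserves_finpres.
- exact: mu_base_ff.
- move=> [X MX]; have [K [s [r [MK e]]]] := M_summand_mu MX.
  by exists (exist M K MK : costabM M), s, r.
move=> [X MX] [Y MY]; have [S [i1 [i2 [p1 [p2 b]]]]] := ex_biprod X Y.
have MS := M_biprod hM b MX MY; have [e1 e2 e3 e4 e5] := b.
exists (exist M S MS : costabM M).
exists (cls Inj i1), (cls Inj i2), (cls Inj p1), (cls Inj p2); split.
- by rewrite [LHS]cls_comp e1.
- by rewrite [LHS]cls_comp e2.
- by rewrite [LHS]cls_comp e3 cls0.
- by rewrite [LHS]cls_comp e4 cls0.
by rewrite [X in X + _]cls_comp [X in _ + X]cls_comp -[LHS]clsD e5.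
Qed.

End MuWellDefined.

Lemma bij_lfun_inv (k : fieldType) (V W : vectType k) (f : 'Hom(V, W)) :
  bijective f -> exists g : 'Hom(W, V), cancel f g /\ cancel g f.
Proof.
move=> [g fg gf]; have gl : linear g.
  by move=> a u v; apply: (can_inj fg); rewrite gf linearP /= !gf.
by exists (linfun g); split=> u; rewrite linfun_linE.
Qed.

Lemma module_hom_inv (k : fieldType) (D : lincat k) (A N : module D)
    (f : module_hom A N) : (forall X, bijective (f X)) ->
  exists g : module_hom N A,
    module_comp g f = module_id A /\ module_comp f g = module_id N.
Proof.
move=> bf; pose g X := projT1 (cid (bij_lfun_inv (bf X))).
have fg X : cancel (f X) (g X) by rewrite /g; case: cid => ? [].
have gf X : cancel (g X) (f X) by rewrite /g; case: cid => ? [].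
have gn (X Y : D) (h : lhom X Y) a : g X (mact N h a) = mact A h (g Y a).
  by apply: (can_inj (fg X)); rewrite gf mhom_nat gf.
exists (ModuleHom gn); split; apply: module_homP => X a.
  by rewrite [LHS]comp_lfunE [RHS]id_lfunE; exact: fg.
by rewrite [LHS]comp_lfunE [RHS]id_lfunE; exact: gf.
Qed.

(** * The comparison isomorphism *)

Section Cup.
Variables (k : fieldType) (B : exactcat k).
Variables (PP : enough_projectives B) (IP : enough_injectives B).
Local Notation Proj := (@projective k B).
Local Notation Inj := (@injective k B).
Local Notation Cs X := (cosyz (IP X)).
Local Notation pI X := (cosyz_out (IP X)).
Local Notation cI X := (inj_pres_conf (IP X)).
Implicit Types X Y Z N : B.

Definition cosyz_class_rep Z := projT1 (cid (conn_exists PP (cI Z))).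

(* Yoneda product with the class of 0 -> Z -> I -> Omegabar Z -> 0. *)
Definition cup N Z (u : lhom N (Cs Z)) : Ext1 PP N Z :=
  ext1_pull PP Z (cls Proj u) (qcls (ext_bound PP (Cs Z) Z) (cosyz_class_rep Z)).

Lemma cosyz_class_repP Z :
  conn (PP := PP) (ihull_in (IP Z)) (pI Z) (cosyz_class_rep Z).
Proof. by rewrite /cosyz_class_rep; case: cid. Qed.

Lemma cup_linear N Z : linear (@cup N Z).
Proof. by move=> a u v; rewrite /cup cls_linear ext1_pull_linl. Qed.

Lemma cup_eq0 N Z (u : lhom N (Cs Z)) :
  cup u = 0 <-> exists h, u = pI Z \oc h.
Proof. exact: conn_pull0 (cI Z) (cosyz_class_repP Z). Qed.

Lemma cup_onto N Z (e : Ext1 PP N Z) : exists u : lhom N (Cs Z), cup u = e.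
Proof.
apply: (conn_onto (cI Z) (cosyz_class_repP Z)).
rewrite -(qrepK e) ext1_pushE; apply/qcls_ext0.
exact/extendable_inj/ihull_inj.
Qed.

Lemma cup_nat N N' Z Z' (f : lhom N' N) (g : lhom Z Z') h (u : lhom N (Cs Z)) :
  cosyz_lift g h ->
  cup (h \oc u \oc f) = ext1_push PP N' g (ext1_pull PP Z (cls Proj f) (cup u)).
Proof.
move=> [h' [e1 e2]]; rewrite /cup !ext1_push_pull.
rewrite (conn_nat (cI Z') (cosyz_class_repP Z) (cosyz_class_repP Z') e1 e2).
have clsM (X Y V : B) (b : lhom Y V) (a : lhom X Y) : cls Proj (b \oc a) =
    (cls Proj b : lhom (Y : stab B) (V : stab B)) \oc
    (cls Proj a : lhom (X : stab B) (Y : stab B)) by rewrite /= cls_comp.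
by rewrite !clsM !ext1_pullM.
Qed.

End Cup.

Section Comparison.
Variables (k : fieldType) (B : exactcat k).
Variables (PP : enough_projectives B) (IP : enough_injectives B).
Variables (n : nat) (M : B -> Prop).
Hypotheses (hn : (2 <= n)%N) (hM : cluster_tilting PP n M).
Variable T : AR_translation PP.
Hypothesis hT : higher_AR IP n T.
Local Notation Proj := (@projective k B).
Local Notation Inj := (@injective k B).
Local Notation Cs X := (cosyz (IP X)).
Local Notation pI X := (cosyz_out (IP X)).
Local Notation cI X := (inj_pres_conf (IP X)).
Local Notation PX := (lperp PP (n - 2) Proj).
Local Notation IY := (rperp PP (n - 2) Inj).
Local Notation LHom X Z := (lhom (Z : costab B) (htau n T X)).
Local Notation RExt X Z := (Ext1 PP (htaum IP n T (Cs Z)) X).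
Implicit Types X Y Z N : B.

(** The components at X and Z of the isomorphism from G(tau_{n-1} X) to mu(F X), with naturality
    stated for morphisms of [B] before passing to quotients. *)
Definition comparison (a : forall X Z, 'Hom(LHom X Z, RExt X Z)) :=
  (forall X Z, PX X -> M Z -> bijective (a X Z)) /\
  (forall X X' Z Z' (f : lhom X' X) (g : lhom Z Z'),
     PX X -> PX X' -> M Z -> M Z' -> forall w,
     a X Z (act_cohom f g w) =
     ext1_push PP _ f (ext1_pull PP X'
       (lmap (lfcomp (htaum IP n T) (Omegabar IP)) (cls Inj g)) (a X' Z' w))).

(** The other pairing is [t X Z (cup PP u) w]. As [cup] is onto and kills exactly the maps lifting
    along [pI Z], it has the left kernel prescribed for [A]. *)
Lemma comparison_of_pairing j
    (A : forall X Z, lhom (syzn PP j X) (Cs Z) -> RExt X Z -> k^o) :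
  dual_iso PX IY (@act_ext k B PP j.+1) (@act_cohom k B (htau n T)) ->
  (forall X Z, PX X -> M Z -> [/\ bilin (@A X Z), onto_dual (@A X Z)
     & forall u, (forall w, A X Z u w = 0) <-> exists h, u = pI Z \oc h]) ->
  (forall X X' Z Z' (f : lhom X' X) (h : lhom (Cs Z) (Cs Z')),
     PX X -> PX X' -> M Z -> M Z' ->
     exists fj : lhom (syzn PP j X') (syzn PP j X),
       cls Proj fj = lmap (lfiter j (Omega PP)) (cls Proj f) /\
       forall u w, A X' Z' (h \oc u \oc fj) w = A X Z u (ext1_push PP _ f
         (ext1_pull PP X' (lmap (htaum IP n T) (cls Inj h)) w))) ->
  exists a, comparison a.
Proof.
have M_IY Z : M Z -> IY Z by move/(M_sub_rperp hn hM)/(rperp_M_Inj hM).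
move=> [t [bt nt]] AP An.
have [|a aP] := @pairing_family k B B (fun X Z => PX X /\ M Z) _ _ _
    (fun X Z (u : lhom (syzn PP j X) (Cs Z)) (w : LHom X Z) => t X Z (cup PP u) w) A.
  move=> X Z [hX MZ]; have [bA oA kA] := AP _ _ hX MZ.
  have btX := bt _ _ hX (M_IY _ MZ); split=> //.
  - split=> [w x u v|u x v w]; last exact: linearP.
    by rewrite cup_linear linearP add_lfunE scale_lfunE.
  - move=> f; have [v vE] := onto_dual_bij btX f.
    have [u uE] := @cup_onto _ _ PP IP (syzn PP j X) Z v.
    by exists u => w; rewrite uE.
  move=> u; rewrite kA; apply: iff_trans (iff_sym (dual_bij_eq0 _ btX)).
  exact: iff_sym (cup_eq0 _ _).
exists a; split=> [X Z hX MZ|X X' Z Z' f g hX hX' MZ MZ' w].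
  by have [] := aP _ _ (conj hX MZ).
have [_ aE sep] := aP _ _ (conj hX MZ); have [_ aE' _] := aP _ _ (conj hX' MZ').
(* Tested on [u], naturality follows from that of [cup], [t] and [A]. *)
apply: sep => u.
have [h hL] := cosyz_lift_exists IP g.
have -> : lmap (lfcomp (htaum IP n T) (Omegabar IP)) (cls Inj g) =
    lmap (htaum IP n T) (cls Inj h).
  congr (lmap (htaum IP n T) _); apply: (cls_cosyz_map (f' := g)) => //.
  by rewrite clsK.
have [fj [fjE <-]] := An _ _ _ _ f h hX hX' MZ MZ'.
rewrite -aE -aE' (cup_nat PP fj u hL) fjE.
by apply: esym; apply: nt => //; exact: M_IY.
Qed.

(** Injectives lie in M, so Ext^1(J, Z) = 0 lets the ideal of injectives, the kernel met for n = 2,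
    be tested on the hull of Z alone. *)
Lemma cup_kernel N Z (u : lhom N (Cs Z)) : M Z ->
  u \in ideal Inj N (Cs Z) <-> exists h, u = pI Z \oc h.
Proof.
move=> MZ; split=> [/injective_factors[J [b [a [JI ->]]]]|[h ->]].
  have [b' ->] := extendable_lift (cI Z) (M_ext1 hn hM (M_inj hM JI) MZ) b.
  by exists (b' \oc a); rewrite lcompA.
by apply: ideal_through; exact: ihull_inj.
Qed.

Lemma lmap_cls (C : B -> Prop) (A : lincat k) (F : lfunctor (quot C) A)
    (X Y Z : B) (g : lhom Y Z) (f : lhom X Y) :
  lmap F (cls C (g \oc f)) =
  lmap F (cls C g : lhom (Y : quot C) (Z : quot C)) \oc
  lmap F (cls C f : lhom (X : quot C) (Y : quot C)).
Proof. by rewrite -lmapM /= cls_comp. Qed.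

End Comparison.

(** * The second pairing, for n = 2 and for n >= 3 *)

Section ComparisonCases.
Variables (k : fieldType) (B : exactcat k).
Variables (PP : enough_projectives B) (IP : enough_injectives B).
Variable M : B -> Prop.
Variable T : AR_translation PP.
Local Notation Proj := (@projective k B).
Local Notation Inj := (@injective k B).
Local Notation Cs X := (cosyz (IP X)).
Local Notation pI X := (cosyz_out (IP X)).
Local Notation iO X := (syz_in (PP X)).

(** The pairing evaluates the duality Ext^1(tau^- Omegabar Z, X) = D Hom(tau^- X, tau^- Omegabar Z)
    at tau^- u. As [u] enters the second argument, [perfect_flip] gives surjectivity; full
    faithfulness of tau^- gives the kernel. *)
Lemma comparison2 : cluster_tilting PP 2 M -> higher_AR IP 2 T ->
  exists a, comparison (n := 2) (IP := IP) (T := T) M a.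
Proof.
move=> hM hT; have hn : (2 <= 2)%N by [].
have [t [bt nt]] := hAR_dualitym hT.
have hM0 (Z : B) : lperp PP (2 - 2) Proj Z by move=> i Y; case: i.
have hI0 (Z : B) : rperp PP (2 - 2) Inj Z by move=> i Y; case: i.
pose A (X Z : B) (u : lhom (syzn PP 0 X) (Cs Z))
    (w : Ext1 PP (htaum IP 2 T (Cs Z)) X) : k^o :=
  t (htaum IP 2 T (Cs Z)) X w
    (lmap (htaum IP 2 T) (cls Inj u : lhom (X : costab B) (Cs Z : costab B))).
apply: (comparison_of_pairing (j := 0) (A := A) hn hM (hAR_duality hT)).
  move=> X Z hX MZ.
  have btX : bijective (t (htaum IP 2 T (Cs Z)) X) by exact: bt.
  have ff := htaum_ff IP T (X : B) (hI0 (Cs Z)).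
  split.
  - split=> [w x u v|u x v w]; rewrite /A.
      by rewrite cls_linear lmap_lin linearP.
    by rewrite linearP add_lfunE scale_lfunE.
  - move=> f; have [h hE] := perfect_flip f btX.
    have [g gE] := ff.2 h; have [u uE] := quot_lift g.
    by exists u => w; rewrite /A -uE gE hE.
  move=> u; rewrite -(cup_kernel hn hM u MZ) -cls_eq0.
  split=> [u0|u0 w]; last by rewrite /A u0 lmap0 linear0.
  apply: ff.1; apply: dual_sep => f.
  by have [s st ts] := btX; rewrite -(ts f); exact: u0.
move=> X X' Z Z' f h _ _ _ _; exists f; split=> // u w.
(* The naturality of [t] concerns morphisms of [B], hence a representative of the stable
   morphism. *)
have [r rE] := quot_lift (lmap (htaum IP 2 T)
  (cls Inj h : lhom (Cs Z : costab B) (Cs Z' : costab B))).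
have := nt _ _ _ _ r f (hM0 _) (hM0 _) (hI0 _) (hI0 _) w.
rewrite /A => nt'; rewrite rE; apply: etrans (esym (nt' _)).
by congr (t _ _ w _); rewrite !lmap_cls /act_hom -rE.
Qed.

(** The duality with i = 1 pairs Ext^1(tau_{n-1}^- Omegabar Z, X) with Ext^{m+1}(X, Omegabar Z) =
    Ext^1(Omega^m X, Omegabar Z), where [u] acts through its class. *)
Lemma comparison3 m : cluster_tilting PP m.+3 M -> higher_AR IP m.+3 T ->
  exists a, comparison (n := m.+3) (IP := IP) (T := T) M a.
Proof.
move=> hM hT; have hn : (2 <= m.+3)%N by [].
have [t [bt nt]] : dual_iso (lperp PP m.+1 Proj) (rperp PP m.+1 Inj)
   (@act_ext k B PP m.+1) (@act_ext_s k B PP 1 (htaum IP m.+3 T)).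
  exact: (hAR_extm hT (i := 1)).
have hI Z : M Z -> rperp PP m.+1 Inj (Cs Z) by exact: (rperp_Cs hn hM).
pose A (X Z : B) (u : lhom (syzn PP m.+1 X) (Cs Z))
    (w : Ext1 PP (htaum IP m.+3 T (Cs Z)) X) : k^o :=
  t X (Cs Z) (qcls (ext_bound PP (syzn PP m X) (Cs Z)) u) w.
apply: (comparison_of_pairing (j := m.+1) (A := A) hn hM (hAR_duality hT)).
  move=> X Z hX MZ.
  have btX : bijective (t X (Cs Z)) := bt _ _ hX (hI _ MZ).
  split.
  - split=> [w x u v|u x v w]; rewrite /A.
      by rewrite qcls_linear linearP add_lfunE scale_lfunE.
    by rewrite linearP.
  - move=> f; have [v vE] := onto_dual_bij btX f.
    by exists (qrep v) => w; rewrite /A qrepK vE.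
  move=> u; apply: iff_trans (dual_bij_eq0 _ btX) _.
  (* A map from the projective middle term lifts along [pI Z]; conversely, a map from the syzygy to
     the hull of Z extends along [iO]. *)
  apply: iff_trans (qcls_ext0 _) _; split=> -[h ->].
    have [|h' ->] := pO_lift h (p := pI Z); last first.
      by exists (h' \oc iO (syzn PP m X)); rewrite lcompA.
    by exists Z, (ihull_in (IP Z)); exact: inj_pres_conf.
  have [h' ->] := extendable_inj (PP := PP) (N := syzn PP m X)
    (@ihull_inj _ _ _ (IP Z)) h.
  by exists (pI Z \oc h'); rewrite lcompA.
move=> X X' Z Z' f h hX hX' MZ MZ'.
exists (syz_map PP (qrep (lmap (lfiter m (Omega PP))
  (cls Proj f : lhom (X' : stab B) (X : stab B))))); split=> // u w.
apply: etrans (nt _ _ _ _ f h hX hX' (hI _ MZ) (hI _ MZ') _ _).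
congr (t _ _ _ w); rewrite /act_ext /ext_map.
have L := syz_mapP PP (qrep (lmap (lfiter m (Omega PP))
  (cls Proj f : lhom (X' : stab B) (X : stab B)))).
have := ext1_pullE u L; rewrite clsK => ->.
by rewrite ext1_pushE lcompA.
Qed.

Lemma comparison_exists n : (2 <= n)%N -> cluster_tilting PP n M ->
  higher_AR IP n T -> exists a, comparison (n := n) (IP := IP) (T := T) M a.
Proof. by case: n => [|[|[|m]]] // _; [exact: comparison2|exact: comparison3]. Qed.

End ComparisonCases.

Local Close Scope ring_scope.

Theorem theorem3p14 (k : fieldType) (B : exactcat k) (hKS : krull_schmidt B)
    (PP : enough_projectives B) (IP : enough_injectives B)
    (n : nat) (hn : 2 <= n) (M : B -> Prop) (hM : cluster_tilting PP n M)
    (T : AR_translation PP) (hT : higher_AR IP n T) :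
  exists (wT : left_wd M n T) (wF : F_wd PP M n) (wG : G_wd PP M n)
         (wE : mu_base_wd IP M n T) (wmu : preserves_finpres (mu_base wE)),
    nat_iso (fcomp (G_arrow wG) (left_arrow wT))
            (fcomp (mu_arrow wmu) (F_arrow wF)).
Proof.
have wT := left_well_defined hn hM hT; have wF := F_well_defined IP hn hM.
have wG := G_well_defined hn hM; have wE := mu_base_well_defined hn hM hT.
exists wT, wF, wG, wE, (mu_well_defined hn hM hT wE).
have [a [ba na]] := comparison_exists hn hM hT.
set GT := fcomp _ _; set mF := fcomp _ _.
have hP (X : full (A := quot M) (lperp PP (n - 2) M)) :
  lperp PP (n - 2) (@projective k B) (sval X) := lperp_M_Proj hM (svalP X).
have cM (X : full (A := quot M) (lperp PP (n - 2) M)) (Z Z' : costabM M)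
    (g : lhom Z Z') (w : sval (GT X) Z') :
  a (sval X) (sval Z) (mact (sval (GT X)) g w) =
  mact (sval (mF X)) g (a (sval X) (sval Z') w).
  have [g0 gE] := quot_lift (g : lhom (sval Z : costab B) (sval Z')).
  (* The identity of X isolates naturality in Z. *)
  have := na _ _ _ _ (@lid k B (sval X)) g0 (hP X) (hP X) (svalP Z) (svalP Z') w.
  rewrite /act_cohom -gE => e.
  apply: etrans (etrans e _).
    congr (a _ _ _); rewrite [LHS]hom_module_act.
    by rewrite (lmap1 (htau n T)) lcomp1m.
  by rewrite ext1_push1 -(mu_baseE wE).
exists (fun X => @ModuleHom _ _ (sval (GT X)) (sval (mF X))
  (fun Z => a (sval X) (sval Z)) (cM X)).
split=> [X Y f|X]; last first.
  have [g [e1 e2]] := module_hom_inv (f := @ModuleHom _ _ (sval (GT X))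
    (sval (mF X)) (fun Z => a (sval X) (sval Z)) (cM X))
    (fun Z => ba _ _ (hP X) (svalP Z)).
  by exists g.
apply: module_homP => Z w.
rewrite [LHS]comp_lfunE [RHS]comp_lfunE /=.
(* The identity of Z isolates naturality in X. *)
have := na _ _ _ _ (qrep f) (@lid k B (sval Z)) (hP Y) (hP X) (svalP Z) (svalP Z) w.
have -> : lmap (lfcomp (htaum IP n T) (Omegabar IP))
    (cls (@injective k B) (@lid k B (sval Z))) = lid _ by apply: lmap1.
rewrite ext1_pull1 => <-; congr (a _ _ _).
set r := qrep _.
(* [r] is the representative chosen by the left arrow, [r'] the one coming from [htau]; they agree
   modulo [cosyz_class M], which G does not see. *)
pose r' := qrep (lmap (htau n T) (cls (@projective k B) (qrep f))).
pose tX : B := htau n T (sval X); pose tY : B := htau n T (sval Y).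
have rr' : fmap (cohomM M) (r : hom (tX : cat_of B) tY) =
    fmap (cohomM M) (r' : hom (tX : cat_of B) tY).
  apply: (mod_induces_map wG); try exact: (induces_ob wT (svalP _)).
  exact: qrep_cls.
have e := congr1
  (fun m : module_hom (cohomM M tX) (cohomM M tY) => m Z w) rr'.
apply: etrans e _.
rewrite [LHS]hom_module_mapE /act_cohom.
have -> : cls (@injective k B) (@lid k B (sval Z)) = lid (sval Z : costab B) by [].
rewrite lcompm1; congr lcomp; exact: clsK.
Qed.
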